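(* The word length $|x|$ of an element $x\in 2V$ and the number of carets $M(x)$ of its reduced grid diagram satisfy $$\log M(x)\prec |x|\prec M(x)\log M(x),$$ that is, there exists a constant $C>0$ such that for all $x\in 2V$, $$\log M(x)\le C\,|x|+C\qquad\text{and}\qquad |x|\le C\,M(x)\log M(x)+C .$$
   Context: A basic dyadic interval is an interval $\left[\frac{i-1}{2^k},\frac{i}{2^k}\right]$ with $k\in\{0,1,2,\dots\}$ and $i\in\{1,\dots,2^k\}$. A basic dyadic rectangle is a product of two basic dyadic intervals. (To obtain honest bijections, intervals may be taken half-open and the unit square to be $[0,1)^2$.) A dyadic subdivision of the unit square is a partition of it into finitely many basic dyadic rectangles obtained from the whole square by repeatedly halving rectangles, either by a vertical segment (left/right halves) or by a horizontal segment (top/bottom halves). The group $2V$ consists of all bijections $f$ of the unit square for which there exist two dyadic subdivisions with the same number of rectangles (source and target) and a bijection between their rectangles such that $f$ maps each source rectangle onto the corresponding target rectangle by the affine map $(x,y)\mapsto(2^{p}x+c,\,2^{q}y+d)$ ($p,q\in\mathbb{Z}$). ''$f$ is affine on a rectangle'' means that $f$ restricts there to a single map of this form. A subdivision is encoded by a rooted binary tree with two types of carets, a triangular (vertical-type) caret recording a halving into left and right halves (left child = left half) and a square (horizontal-type) caret recording a halving into top and bottom halves (left child = top half). Grid diagrams. A grid diagram of $f\in 2V$ is given by two finite rooted binary trees $T_v$ and $T_h$, where the leaves of $T_v$ are the intervals $I_1,\dots,I_m$ of a subdivision of the bottom edge $[0,1]$ by iterated halving, and the leaves of $T_h$ are the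 intervals $J_1,\dots,J_n$ of a subdivision of the left edge $[0,1]$ by iterated halving, such that for all $i,j$ the map $f$ is affine on $I_i\times J_j$ and its image is a basic dyadic rectangle. The diagram is reduced if: for every exposed caret of $T_v$ (interior node both of whose children are leaves), with leaves $I_i,I_{i+1}$, there is a $j$ such that $f$ is not affine on $(I_i\cup I_{i+1})\times J_j$ or the image of $(I_i\cup I_{i+1})\times J_j$ is not a basic dyadic rectangle; and the analogous condition with the roles of the coordinates exchanged holds for every exposed caret of $T_h$. Every element of $2V$ has a unique reduced grid diagram. $M(x)$ is the number of carets of the reduced grid diagram of $x$, i.e. the number of carets (interior nodes) of the binary tree of its source subdivision, obtained by hanging a copy of $T_h$ from each leaf of $T_v$; so $M(x)=mn-1$ where $m,n$ are the numbers of leaves of $T_v,T_h$. By convention $\log M(x)$ and $M(x)\log M(x)$ are read as $0$ when $M(x)=0$ (which happens only for the identity). $|x|$ is the word length of $x$ with respect to the standard finite generating set $\{A_0,A_1,B_0,B_1,\Pi_0,\overline{\Pi}_0,\Pi_1,\overline{\Pi}_1\}$ of $2V$ (due to Brin); replacing it by another finite generating set only changes the constant. Here let $R_k$ denote the all-right tree with $k$ carets, all of them triangular, with leaves numbered $0,\dots,k$ from left to right. $A_i$ (respectively $B_i$) is the element with source tree $R_{i+1}$ with a triangular (respectively square) caret attached at leaf $i$, and target tree $R_{i+2}$, matching leaves in left-to-right order. $\Pi_i$ has source and target tree $R_{i+2}$ and exchanges leaves $i$ and $i+1$, fixing the others. $\overline{\Pi}_i$ has source and target tree $R_{i+1}$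 and exchanges leaves $i$ and $i+1$, fixing the others. *)

(* Defs.v *)
From HB Require Import structures.
From mathcomp Require Import all_boot all_order all_algebra.
From mathcomp Require Import all_classical all_reals all_analysis.

Set Implicit Arguments.
Unset Strict Implicit.
Unset Printing Implicit Defensive.
Import Order.TTheory GRing.Theory Num.Theory.
Local Open Scope classical_set_scope.
Local Open Scope ring_scope.

Definition usquare (R : realType) : Type :=
  {z : R * R | (0 <= z.1 < 1) && (0 <= z.2 < 1)}.

(* (k, i) encodes [i/2^k, (i+1)/2^k); the index i starts at 0. *)
Definition dyadic : Type := (nat * nat)%type.

Definition dyadic_valid (I : dyadic) : bool := (I.2 < 2 ^ I.1)%N.

Definition dyadic_unit : dyadic := (0, 0)%N.

Definition lower_half (I : dyadic) : dyadic := (I.1.+1, I.2.*2).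

Definition upper_half (I : dyadic) : dyadic := (I.1.+1, I.2.*2.+1).

Definition dyadic_set (R : realType) (I : dyadic) : set R :=
  [set t | I.2%:R / 2 ^+ I.1 <= t < I.2.+1%:R / 2 ^+ I.1].

(* Horizontal extent first, vertical extent second. *)
Definition drect : Type := (dyadic * dyadic)%type.

Definition rect_set (R : realType) (A : drect) : set (usquare R) :=
  [set z | dyadic_set A.1 (val z).1 /\ dyadic_set A.2 (val z).2].

Definition basic_dyadic_rectangle (R : realType) (S : set (usquare R)) : Prop :=
  exists A : drect,
    [/\ dyadic_valid A.1, dyadic_valid A.2 & S = rect_set A].

Inductive caret_kind : Type := Triangular | Square.

Inductive tree : Type := Leaf | Caret of caret_kind & tree & tree.

Fixpoint num_leaves (t : tree) : nat :=
  if t is Caret _ l r then (num_leaves l + num_leaves r)%N else 1%N.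

Fixpoint num_carets (t : tree) : nat :=
  if t is Caret _ l r then (num_carets l + num_carets r).+1 else 0%N.

(* The left child of a square caret is the top half. *)
Fixpoint leaf_rects_in (A : drect) (t : tree) : seq drect :=
  match t with
  | Leaf => [:: A]
  | Caret Triangular l r =>
      leaf_rects_in (lower_half A.1, A.2) l
      ++ leaf_rects_in (upper_half A.1, A.2) r
  | Caret Square l r =>
      leaf_rects_in (A.1, upper_half A.2) l
      ++ leaf_rects_in (A.1, lower_half A.2) r
  end.

Definition unit_rect : drect := (dyadic_unit, dyadic_unit).

Definition subdivision (t : tree) : seq drect := leaf_rects_in unit_rect t.

Definition leaf_rect (t : tree) (i : nat) : drect :=
  nth unit_rect (subdivision t) i.

Definition affine_on (R : realType) (f : usquare R -> usquare R)
    (S : set (usquare R)) : Prop :=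
  exists (p q : int) (c d : R), forall z, S z ->
    val (f z) = (2 ^ p * (val z).1 + c, 2 ^ q * (val z).2 + d).

(* Leaf i of the source tree S is sent to leaf s i of the target tree T; the
   values of s beyond the leaves of S are irrelevant. *)
Definition tree_pair (R : realType) (f : usquare R -> usquare R)
    (S T : tree) (s : nat -> nat) : Prop :=
  [/\ num_leaves S = num_leaves T,
      set_bij `I_(num_leaves S) `I_(num_leaves T) s
    & forall i, (i < num_leaves S)%N ->
        affine_on f (rect_set (leaf_rect S i)) /\
        f @` rect_set (leaf_rect S i) = rect_set (leaf_rect T (s i))].

Definition in_2V (R : realType) (f : usquare R -> usquare R) : Prop :=
  bijective f /\ exists S T s, tree_pair f S T s.

Fixpoint right_tree (k : nat) : tree :=
  if k is k'.+1 then Caret Triangular Leaf (right_tree k') else Leaf.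

(* Replaces leaf i of t, leaves being numbered from 0, by the tree u. *)
Fixpoint attach (u t : tree) (i : nat) : tree :=
  match t with
  | Leaf => u
  | Caret c l r =>
      if (i < num_leaves l)%N then Caret c (attach u l i) r
      else Caret c l (attach u r (i - num_leaves l))
  end.

Definition exchange (i : nat) : nat -> nat :=
  [eta id with i |-> i.+1, i.+1 |-> i].

(* A tree pair determines the map, so each of the next four predicates
   characterizes a single element. *)
Definition is_A (R : realType) (i : nat) (f : usquare R -> usquare R) : Prop :=
  tree_pair f (attach (Caret Triangular Leaf Leaf) (right_tree i.+1) i)
    (right_tree i.+2) id.

Definition is_B (R : realType) (i : nat) (f : usquare R -> usquare R) : Prop :=
  tree_pair f (attach (Caret Square Leaf Leaf) (right_tree i.+1) i)
    (right_tree i.+2) id.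

Definition is_Pi (R : realType) (i : nat) (f : usquare R -> usquare R) : Prop :=
  tree_pair f (right_tree i.+2) (right_tree i.+2) (exchange i).

Definition is_Pibar (R : realType) (i : nat) (f : usquare R -> usquare R) :
    Prop :=
  tree_pair f (right_tree i.+1) (right_tree i.+1) (exchange i).

Definition generator (R : realType) (f : usquare R -> usquare R) : Prop :=
  exists i : nat, (i = 0%N \/ i = 1%N) /\
    [\/ is_A i f, is_B i f, is_Pi i f | is_Pibar i f].

Definition letter (R : realType) (g : usquare R -> usquare R) : Prop :=
  generator g \/ exists f, [/\ generator f, cancel f g & cancel g f].

Inductive product_of_letters (R : realType) :
    nat -> (usquare R -> usquare R) -> Prop :=
| product_nil : product_of_letters 0 id
| product_cons (n : nat) (g f : usquare R -> usquare R) :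
    letter g -> product_of_letters n f -> product_of_letters n.+1 (g \o f).

(* The default 0 is never reached on 2V, which the letters generate. *)
Definition word_length (R : realType) (x : usquare R -> usquare R) : nat :=
  xget 0%N [set n | product_of_letters n x /\
                    forall m, product_of_letters m x -> (n <= m)%N].

Inductive btree : Type := BLeaf | BCaret of btree & btree.

Fixpoint leaf_intervals_in (I : dyadic) (t : btree) : seq dyadic :=
  if t is BCaret l r then
    leaf_intervals_in (lower_half I) l ++ leaf_intervals_in (upper_half I) r
  else [:: I].

Definition leaf_intervals (t : btree) : seq dyadic :=
  leaf_intervals_in dyadic_unit t.

(* An exposed caret is recorded by the interval of its node, which is the union
   of the intervals of its two leaves. *)
Fixpoint exposed_intervals_in (I : dyadic) (t : btree) : seq dyadic :=
  match t with
  | BLeaf => [::]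
  | BCaret BLeaf BLeaf => [:: I]
  | BCaret l r =>
      exposed_intervals_in (lower_half I) l
      ++ exposed_intervals_in (upper_half I) r
  end.

Definition exposed_intervals (t : btree) : seq dyadic :=
  exposed_intervals_in dyadic_unit t.

Definition grid_diagram (R : realType) (f : usquare R -> usquare R)
    (Tv Th : btree) : Prop :=
  forall I J, I \in leaf_intervals Tv -> J \in leaf_intervals Th ->
    affine_on f (rect_set (I, J)) /\
    basic_dyadic_rectangle (f @` rect_set (I, J)).

Definition reduced_grid_diagram (R : realType) (f : usquare R -> usquare R)
    (Tv Th : btree) : Prop :=
  [/\ grid_diagram f Tv Th,
      forall I, I \in exposed_intervals Tv ->
        exists2 J, J \in leaf_intervals Th &
          ~ affine_on f (rect_set (I, J)) \/
          ~ basic_dyadic_rectangle (f @` rect_set (I, J))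
    & forall J, J \in exposed_intervals Th ->
        exists2 I, I \in leaf_intervals Tv &
          ~ affine_on f (rect_set (I, J)) \/
          ~ basic_dyadic_rectangle (f @` rect_set (I, J))].

(* In T_h the left child is the lower half, whereas the left child of a square
   caret is the top half: hence the exchange of children. *)
Fixpoint tree_of_v (t : btree) : tree :=
  if t is BCaret l r then Caret Triangular (tree_of_v l) (tree_of_v r)
  else Leaf.

Fixpoint tree_of_h (t : btree) : tree :=
  if t is BCaret l r then Caret Square (tree_of_h r) (tree_of_h l) else Leaf.

Fixpoint hang (u t : tree) : tree :=
  if t is Caret c l r then Caret c (hang u l) (hang u r) else u.

Definition grid_tree (Tv Th : btree) : tree := hang (tree_of_h Th) (tree_of_v Tv).

(* The reduced grid diagram of an element of 2V exists and is unique, so the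
   default 0 plays no role there. The value is 0 for the identity; the library
   sets ln 0 = 0, so both ln M and M * ln M are then 0. *)
Definition grid_carets (R : realType) (x : usquare R -> usquare R) : nat :=
  xget 0%N [set m | exists Tv Th,
    reduced_grid_diagram x Tv Th /\ m = num_carets (grid_tree Tv Th)].

(* Main.v *)
(* Each letter carries every sufficiently fine dyadic cell affinely onto a
   dyadic cell whose level in either coordinate has dropped by at most 4. Hence
   a product of n letters is affine on the cells of the uniform grid of level
   4n, a reduced grid diagram is not deeper than this grid, and M(x) < 2^(8n).

   Conversely, the cells of a grid diagram of x are carried to the cells of a
   partition of the square into N = M(x) + 1 dyadic rectangles. In dimension two
   every such partition is the subdivision of some tree, so x is a tree pair
   with N leaves. Replacing a tree by another one with as many leaves costs
   O(N) letters, so both trees may be taken balanced, of depth O(log N); there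
   the transposition of a fixed leaf with another one costs O(log N) letters,
   and a permutation of the leaves is a product of at most 3N of these. *)
Require Import Defs.
From mathcomp Require Import all_boot all_order all_algebra all_fingroup.
From mathcomp Require Import all_classical all_reals all_analysis.
From mathcomp Require Import ring lra zify.
Set Implicit Arguments.
Unset Strict Implicit.
Unset Printing Implicit Defensive.
Import Order.TTheory GRing.Theory Num.Theory.
Local Open Scope classical_set_scope.
Local Open Scope ring_scope.

(** * Dyadic cells and affine maps *)

(** The real slopes and offsets disappear at the outset: [f] maps a cell [A] affinely onto a cell
    [B] exactly when it turns the parametrization of [A] by the square into that of [B] ([carries]).
    Words in the letters are then evaluated by rewriting bit strings. A reduced diagram cannot be
    deep because cells glue. If both halves of a cell are carried to cells, and so is a thin strip
    running across both halves, then the strip forces the two images to be the halves of one cell,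
    so the whole cell is carried to a cell. Beyond level 4n such strips always exist. For the upper
    bound, a grid diagram provides a tree only for the source. The image cells are an unstructured
    partition, and in dimension three they need not come from halvings: three bars in the three
    directions can avoid each other and yet block every cut. Trees are compared through a comb that
    depends only on the number of leaves. Balance matters for permutations alone, since moving a
    leaf to a place where a letter acts costs in proportion to its depth. *)

(* The bits lead from the square to the cell, horizontally and vertically; true
   stands for the right half and for the upper half. *)
Definition address : Type := (seq bool * seq bool)%type.

Definition cat_address (A B : address) : address := (A.1 ++ B.1, A.2 ++ B.2).

Definition half (I : dyadic) (b : bool) : dyadic :=
  if b then upper_half I else lower_half I.

Definition dyadic_of (I : dyadic) (w : seq bool) : dyadic := foldl half I w.

Definition rect_of (A : address) : drect :=
  (dyadic_of dyadic_unit A.1, dyadic_of dyadic_unit A.2).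

Lemma dyadic_of_rcons I w b : dyadic_of I (rcons w b) = half (dyadic_of I w) b.
Proof. by rewrite /dyadic_of foldl_rcons. Qed.

Lemma dyadic_of_valid w : dyadic_valid (dyadic_of dyadic_unit w).
Proof.
elim/last_ind: w => [//|w b]; rewrite dyadic_of_rcons /dyadic_valid /half.
by case: b => /=; rewrite expnS; lia.
Qed.

Lemma dyadic_validP I : dyadic_valid I -> exists w, I = dyadic_of dyadic_unit w.
Proof.
case: I => k; elim: k => [|k IH] i; rewrite /dyadic_valid /=.
  by rewrite expn0 ltnS leqn0 => /eqP ->; exists [::].
move=> lti.
have /IH[w Dw] : dyadic_valid (k, i./2).
  by rewrite /dyadic_valid /= ltn_half_double -mul2n -expnS.
exists (rcons w (odd i)); rewrite dyadic_of_rcons -Dw /half.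
have := odd_double_half i; rewrite /upper_half /lower_half /=.
by case: (odd i) => /= {1}<-.
Qed.

Section Square.
Variable R : realType.
Notation sq := (usquare R).
Implicit Types (f g : sq -> sq) (z : sq) (A B C : address).

Definition in_unit (t : R) := (0 <= t < 1).

Lemma half_unit (b : bool) (t : R) : in_unit t -> in_unit ((t + b%:R) / 2).
Proof. by rewrite /in_unit => /andP[? ?]; case: b => /=; apply/andP; split; lra. Qed.

Definition split_point (c : caret_kind) (b : bool) (z : R * R) : R * R :=
  if c is Triangular then ((z.1 + b%:R) / 2, z.2) else (z.1, (z.2 + b%:R) / 2).

Definition in_square (z : R * R) : bool := (0 <= z.1 < 1) && (0 <= z.2 < 1).

Lemma split_point_unit c b (p : R * R) : in_square p -> in_square (split_point c b p).
Proof.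
by case: c => /= /andP[h1 h2]; apply/andP; split => //; exact: half_unit.
Qed.

Definition ins1 c b z : sq :=
  exist (fun w => is_true (in_square w)) (split_point c b (val z))
    (split_point_unit c b (valP z)).

(** The affine parametrization of the cell [A] by the whole square. Bits of different directions
    commute ([ins1C]), so putting the horizontal ones outermost is just a normal form. *)
Definition place A z : sq :=
  foldr (ins1 Triangular) (foldr (ins1 Square) z A.2) A.1.

Definition origin : sq.
Proof. by exists (0, 0) => /=; rewrite lexx ltr01. Defined.

Lemma ins1_inj c b b' z z' : ins1 c b z = ins1 c b' z' -> b = b' /\ z = z'.
Proof.
move=> /(congr1 val); case: z z' => [[x y] hz] [[x' y'] hz'] /=.
have /andP[/= /andP[? ?] /andP[? ?]] := hz.
have /andP[/= /andP[? ?] /andP[? ?]] := hz'.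
case: c => /= -[Ex Ey].
- have Eb : b = b' by move: Ex; case: b b' => [] [] //= Ex; exfalso; lra.
  split=> //; apply: val_inj => /=; subst b' y'; congr pair; lra.
- have Eb : b = b' by move: Ey; case: b b' => [] [] //= Ey; exfalso; lra.
  split=> //; apply: val_inj => /=; subst b' x'; congr pair; lra.
Qed.

Lemma ins1C b b' z :
  ins1 Triangular b (ins1 Square b' z) = ins1 Square b' (ins1 Triangular b z).
Proof. by apply: val_inj. Qed.

Lemma ins1_cover c z : exists b z', z = ins1 c b z'.
Proof.
suff [b [w hw E]] : exists b, exists2 w : R * R, (0 <= w.1 < 1) && (0 <= w.2 < 1) &
    split_point c b w = val z.
  by exists b, (exist _ w hw); apply: val_inj.
case: z => [[x y] hz] /=; have /andP[/= /andP[? ?] /andP[? ?]] := hz.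
case: c => /=; [exists (1/2 <= x), (2 * x - (1/2 <= x)%R%:R, y)
  | exists (1/2 <= y), (x, 2 * y - (1/2 <= y)%R%:R)] => /=; last 1 first.
- by congr pair; lra.
- by case: (lerP (1/2) x) => ? /=; apply/andP; split; apply/andP; split; lra.
- by congr pair; lra.
- by case: (lerP (1/2) y) => ? /=; apply/andP; split; apply/andP; split; lra.
Qed.

Lemma place_square b u v z : place (u, b :: v) z = ins1 Square b (place (u, v) z).
Proof. by rewrite /place /=; elim: u => //= a u ->; rewrite ins1C. Qed.

Lemma place_cat A B z : place (cat_address A B) z = place A (place B z).
Proof.
case: A B => [u v] [u' v']; rewrite /cat_address /=.
elim: u => [|a u IH]; last by rewrite /place /= -/(place (u ++ u', v ++ v') z) IH.
elim: v => [|b v IH] //=.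
by rewrite !place_square IH.
Qed.

Lemma place_inj A : injective (place A).
Proof.
case: A => u v z z'; elim: u => [|a u IH]; last by move=> /ins1_inj[_ /IH].
by elim: v => [|b v IH] //; rewrite !place_square => /ins1_inj[_ /IH].
Qed.

Lemma ins1_neq c b z z' : ins1 c (~~ b) z <> ins1 c b z'.
Proof. by move=> /ins1_inj[]; case: b. Qed.

Lemma place_triangular b v z :
  place ([::], v) (ins1 Triangular b z) = ins1 Triangular b (place ([::], v) z).
Proof. by elim: v => //= a v IH; rewrite !place_square IH ins1C. Qed.

(** Where one address has a bit and the other has none left in that direction, the shorter one also
    parametrizes points of the opposite half; evaluation at such a point gives the contradiction. *)
Lemma place_eq_address A B : place A =1 place B -> A = B.
Proof.
case: A B => u v [u' v'].
elim: u u' => [|a u IH] [|a' u'] E.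
- elim: v v' E => [|b v IH] [|b' v'] E //.
  + by case: (ins1_neq (E (ins1 Square (~~ b') origin))).
  + by case: (ins1_neq (esym (E (ins1 Square (~~ b) origin)))).
  + have := E origin; rewrite !place_square => /ins1_inj[-> _].
    suff /IH[->] : place ([::], v) =1 place ([::], v') by [].
    by move=> z; have := E z; rewrite !place_square => /ins1_inj[].
- have := E (ins1 Triangular (~~ a') origin).
  by rewrite place_triangular => /ins1_neq.
- have := E (ins1 Triangular (~~ a) origin).
  by rewrite place_triangular => /esym /ins1_neq.
- have /ins1_inj[-> _] := E origin.
  suff /IH[-> ->] : place (u, v) =1 place (u', v') by [].
  by move=> z; have /ins1_inj[] := E z.
Qed.

Lemma half_coord (t : R) (b : bool) I :
  ((t + b%:R) / 2 + I.2%:R) / 2 ^+ I.1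
  = (t + (half I b).2%:R) / 2 ^+ (half I b).1.
Proof.
have n0 : (2 : R) ^+ I.1 != 0 by rewrite expf_neq0.
by case: b => /=; rewrite -?natr1 -mul2n natrM exprS; field.
Qed.

Lemma place_val A z : let D := rect_of A in
  val (place A z) = (((val z).1 + D.1.2%:R) / 2 ^+ D.1.1,
                     ((val z).2 + D.2.2%:R) / 2 ^+ D.2.1).
Proof.
case: A => u v; rewrite /rect_of /=.
elim/last_ind: u z => [|u b IH] z.
  elim/last_ind: v z => [|v b IH] z.
    by rewrite /= !addr0 expr0 !divr1; case: (val z).
  have -> : ([::], rcons v b) = cat_address ([::], v) ([::], [:: b]).
    by rewrite /cat_address /= cats1.
  by rewrite place_cat IH dyadic_of_rcons -half_coord.
have -> : (rcons u b, v) = cat_address (u, v) ([:: b], [::]).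
  by rewrite /cat_address /= cats1 cats0.
by rewrite place_cat IH dyadic_of_rcons -half_coord.
Qed.

Lemma dyadic_setP I (t : R) : dyadic_set I t <->
  exists2 s : R, 0 <= s < 1 & t = (s + I.2%:R) / 2 ^+ I.1.
Proof.
have p0 : 0 < (2 : R) ^+ I.1 by rewrite exprn_gt0.
rewrite /dyadic_set /=; split.
  rewrite ler_pdivrMr // ltr_pdivlMr // -natr1 => /andP[h1 h2].
  exists (t * 2 ^+ I.1 - I.2%:R); first by apply/andP; split; lra.
  by rewrite subrK mulfK // gt_eqF.
move=> [s /andP[h1 h2] ->].
by rewrite ler_pM2r ?invr_gt0 // ltr_pM2r ?invr_gt0 // -natr1; apply/andP; split; lra.
Qed.

Definition point (s t : R) (h : in_square (s, t)) : sq :=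
  exist (fun w => is_true (in_square w)) (s, t) h.

Lemma rect_setP A z : rect_set (rect_of A) z <-> exists z', z = place A z'.
Proof.
rewrite /rect_set /=; split.
  move=> [/dyadic_setP[s hs Es] /dyadic_setP[t ht Et]].
  have hst : in_square (s, t) by rewrite /in_square hs ht.
  exists (point hst).
  by apply: val_inj; rewrite place_val /= [LHS]surjective_pairing Es Et.
move=> [z' ->]; rewrite place_val.
by case: z' => [[x y] hz] /=; have /andP[h1 h2] := hz; split; apply/dyadic_setP;
  [exists x | exists y].
Qed.

(** Being affine on a cell with a cell as image, freed of slopes and offsets ([carriesP]). *)
Definition carries f A B := forall z, f (place A z) = place B z.

Lemma carries_comp f g A B C :
  carries f A B -> carries g B C -> carries (g \o f) A C.
Proof. by move=> fAB gBC z /=; rewrite fAB gBC. Qed.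

Lemma carries_cat f A B C : carries f A B -> carries f (cat_address A C) (cat_address B C).
Proof. by move=> fAB z; rewrite !place_cat fAB. Qed.

Lemma carries_inv f g A B : cancel f g -> carries f A B -> carries g B A.
Proof. by move=> fK fAB z; rewrite -fAB fK. Qed.

Lemma carries_uniq f A B C : carries f A B -> carries f A C -> B = C.
Proof. by move=> fB fC; apply: place_eq_address => z; rewrite -fB -fC. Qed.

(* The infimum of the image interval gives the offset, its length the slope. *)
Lemma affine_interval (a c d e : R) : 0 < a -> 0 < d ->
  (forall s, 0 <= s < 1 -> exists2 s', 0 <= s' < 1 & a * s + c = d * s' + e) ->
  (forall s, 0 <= s < 1 -> exists2 s', 0 <= s' < 1 & d * s + e = a * s' + c) ->
  a = d /\ c = e.
Proof.
move=> a0 d0 hac hde.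
have z01 : 0 <= (0 : R) < 1 by rewrite lexx ltr01.
have ce : c = e.
  have [s /andP[s0 _] E] := hac _ z01; have [t /andP[t0 _] F] := hde _ z01.
  have : 0 <= d * s by rewrite mulr_ge0 // ltW.
  have : 0 <= a * t by rewrite mulr_ge0 // ltW.
  lra.
split=> //; subst e; apply/eqP; rewrite eq_le !leNgt; apply/andP; split; apply/negP => lt.
(* If d < a, the parameter d / a goes to the right end of the other interval, which is excluded
   because the intervals are half-open. *)
- have h : 0 <= d / a < 1 by rewrite divr_ge0 ?ltW //= ltr_pdivrMr // mul1r.
  have [s /andP[_ s1]] := hac _ h; rewrite mulrC divfK ?gt_eqF // => /addIr E.
  by have := ltr_pM2l d0 s 1; rewrite s1 mulr1 -E ltxx.
- have h : 0 <= a / d < 1 by rewrite divr_ge0 ?ltW //= ltr_pdivrMr // mul1r.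
  have [s /andP[_ s1]] := hde _ h; rewrite mulrC divfK ?gt_eqF // => /addIr E.
  by have := ltr_pM2l a0 s 1; rewrite s1 mulr1 -E ltxx.
Qed.

Lemma carries_affine f A B : carries f A B -> affine_on f (rect_set (rect_of A)).
Proof.
move=> fAB; set D := rect_of A; set E := rect_of B.
have slope k l : (2 : R) ^ (k%:Z - l%:Z) = 2 ^+ k / 2 ^+ l.
  by rewrite expfzDr ?pnatr_eq0 // -exprnN.
exists (D.1.1%:Z - E.1.1%:Z), (D.2.1%:Z - E.2.1%:Z),
  ((E.1.2%:R - D.1.2%:R) / 2 ^+ E.1.1), ((E.2.2%:R - D.2.2%:R) / 2 ^+ E.2.1).
move=> _ /rect_setP[z ->]; rewrite fAB !place_val -/D -/E !slope /=.
by congr pair; field; rewrite !expf_neq0.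
Qed.

Lemma carries_image f A B : carries f A B ->
  f @` rect_set (rect_of A) = rect_set (rect_of B).
Proof.
move=> fAB; apply/seteqP; split => z /=.
  by move=> [_ /rect_setP[w ->] <-]; apply/rect_setP; exists w.
move=> /rect_setP[w ->]; exists (place A w); last exact: fAB.
by apply/rect_setP; exists w.
Qed.

(** In each coordinate, [f] after the parametrization of [A] and the parametrization of [B] are
    increasing affine functions on [0,1) with the same range, hence equal by [affine_interval]. *)
Lemma affine_carries f A B : affine_on f (rect_set (rect_of A)) ->
  f @` rect_set (rect_of A) = rect_set (rect_of B) -> carries f A B.
Proof.
set D := rect_of A; set E := rect_of B.
move=> [p [q [c [d aff]]]] im.
have fz z : val (f (place A z)) =
    (2 ^ p / 2 ^+ D.1.1 * (val z).1 + (2 ^ p / 2 ^+ D.1.1 * D.1.2%:R + c),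
     2 ^ q / 2 ^+ D.2.1 * (val z).2 + (2 ^ q / 2 ^+ D.2.1 * D.2.2%:R + d)).
  by rewrite aff ?place_val -/D /=; [congr pair; ring | apply/rect_setP; exists z].
have pz z : val (place B z) =
    ((2 ^+ E.1.1)^-1 * (val z).1 + (2 ^+ E.1.1)^-1 * E.1.2%:R,
     (2 ^+ E.2.1)^-1 * (val z).2 + (2 ^+ E.2.1)^-1 * E.2.2%:R).
  by rewrite place_val -/E /=; congr pair; ring.
have to z : exists z', f (place A z) = place B z'.
  by apply/rect_setP; rewrite -/E -im; exists (place A z) => //; apply/rect_setP; exists z.
have from z : exists z', place B z = f (place A z').
  have : rect_set E (place B z) by apply/rect_setP; exists z.
  by rewrite -im => -[_ /rect_setP[w ->] <-]; exists w.
have pos (k : nat) (r : int) : 0 < (2 : R) ^ r / 2 ^+ k.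
  by rewrite divr_gt0 // ?exprz_gt0 ?exprn_gt0.
have pos' (k : nat) : 0 < ((2 : R) ^+ k)^-1 by rewrite invr_gt0 exprn_gt0.
have u0 : 0 <= (0 : R) < 1 by rewrite lexx ltr01.
have fst_unit z : 0 <= (val z).1 < 1 by have /andP[] := valP z.
have snd_unit z : 0 <= (val z).2 < 1 by have /andP[] := valP z.
(* Points with second coordinate 0 isolate the first coordinate; [to] and [from] are the two
   inclusions between the image and the cell [B]. *)
have [Ea Ec] : 2 ^ p / 2 ^+ D.1.1 = (2 ^+ E.1.1)^-1 :> R /\
    2 ^ p / 2 ^+ D.1.1 * D.1.2%:R + c = (2 ^+ E.1.1)^-1 * E.1.2%:R.
  apply: (affine_interval (pos _ _) (pos' _)) => s hs.
  - have h : in_square (s, 0) by rewrite /in_square hs u0.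
    have [z'] := to (point h); move/(congr1 val); rewrite fz pz /= => -[Es _].
    by exists (val z').1.
  - have h : in_square (s, 0) by rewrite /in_square hs u0.
    have [z'] := from (point h); move/(congr1 val); rewrite fz pz /= => -[Es _].
    by exists (val z').1.
have [Eb Ed] : 2 ^ q / 2 ^+ D.2.1 = (2 ^+ E.2.1)^-1 :> R /\
    2 ^ q / 2 ^+ D.2.1 * D.2.2%:R + d = (2 ^+ E.2.1)^-1 * E.2.2%:R.
  apply: (affine_interval (pos _ _) (pos' _)) => s hs.
  - have h : in_square (0, s) by rewrite /in_square hs u0.
    have [z'] := to (point h); move/(congr1 val); rewrite fz pz /= => -[_ Es].
    by exists (val z').2.
  - have h : in_square (0, s) by rewrite /in_square hs u0.
    have [z'] := from (point h); move/(congr1 val); rewrite fz pz /= => -[_ Es].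
    by exists (val z').2.
by move=> z; apply: val_inj; rewrite fz pz Ec Ed Ea Eb.
Qed.

Lemma carriesP f A B :
  carries f A B <->
  affine_on f (rect_set (rect_of A)) /\
  f @` rect_set (rect_of A) = rect_set (rect_of B).
Proof.
split=> [fAB|[]]; last exact: affine_carries.
by split; [exact: (carries_affine fAB) | exact: carries_image].
Qed.

End Square.

(** * Trees, letters and reachable maps *)

(** Bits record position, whereas children of a square caret are listed from the top; hence its left
    child has bit true. *)
Definition left_bit (c : caret_kind) : bool := if c is Square then true else false.

Definition prefix_bit (c : caret_kind) (b : bool) (A : address) : address :=
  if c is Triangular then (b :: A.1, A.2) else (A.1, b :: A.2).

Fixpoint leaves (t : tree) : seq address :=
  match t with
  | Leaf => [:: ([::], [::])]
  | Caret c l r => map (prefix_bit c (left_bit c)) (leaves l)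
      ++ map (prefix_bit c (~~ left_bit c)) (leaves r)
  end.

Definition leaf (t : tree) (i : nat) : address := nth ([::], [::]) (leaves t) i.

Lemma leaf_rects_inE X t : leaf_rects_in X t =
  [seq (dyadic_of X.1 A.1, dyadic_of X.2 A.2) | A <- leaves t].
Proof.
elim: t X => [|c l IHl r IHr] X /=; first by case: X.
by rewrite map_cat -!map_comp; case: c; rewrite IHl IHr.
Qed.

Lemma subdivisionE t : subdivision t = map rect_of (leaves t).
Proof. exact: leaf_rects_inE. Qed.

Lemma size_leaves t : size (leaves t) = num_leaves t.
Proof. by elim: t => //= c l IHl r IHr; rewrite size_cat !size_map IHl IHr. Qed.

Lemma leaf_rectE t i : leaf_rect t i = rect_of (leaf t i).
Proof.
rewrite /leaf_rect subdivisionE /leaf; have [lt|ge] := ltnP i (size (leaves t)).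
  by rewrite (nth_map ([::], [::])).
by rewrite !nth_default ?size_map.
Qed.

Lemma num_leaves_gt0 t : (0 < num_leaves t)%N.
Proof. by elim: t => //= c l IHl r IHr; rewrite addn_gt0 IHl. Qed.

Lemma leaf_caret c l r i : (i < num_leaves l + num_leaves r)%N ->
  leaf (Caret c l r) i =
  if (i < num_leaves l)%N then prefix_bit c (left_bit c) (leaf l i)
  else prefix_bit c (~~ left_bit c) (leaf r (i - num_leaves l)).
Proof.
move=> lti; rewrite /leaf /= nth_cat size_map size_leaves.
case: ltnP => h; rewrite (nth_map ([::], [::])) ?size_leaves //.
by rewrite ltn_subLR.
Qed.

Lemma leaf_left c l r i : (i < num_leaves l)%N ->
  leaf (Caret c l r) i = prefix_bit c (left_bit c) (leaf l i).
Proof. by move=> lti; rewrite leaf_caret ?lti // ltn_addr. Qed.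

Lemma leaf_right c l r i : (i < num_leaves r)%N ->
  leaf (Caret c l r) (num_leaves l + i) = prefix_bit c (~~ left_bit c) (leaf r i).
Proof.
by move=> lti; rewrite leaf_caret ?ltn_add2l // ltnNge leq_addr addKn.
Qed.

Lemma depth_leaf t A : A \in leaves t ->
  (size A.1 < num_leaves t)%N /\ (size A.2 < num_leaves t)%N.
Proof.
elim: t A => [|c l IHl r IHr] A /=; first by rewrite inE => /eqP ->.
have := num_leaves_gt0 l; have := num_leaves_gt0 r.
rewrite mem_cat => ? ? /orP[] /mapP[B hB ->].
  by have [] := IHl _ hB; case: c => /= *; lia.
by have [] := IHr _ hB; case: c => /= *; lia.
Qed.

Section Trees.
Variable R : realType.
Notation sq := (usquare R).
Implicit Types (f g : sq -> sq) (z : sq) (A B C : address).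

Lemma place_prefix_bit c b A z : place (prefix_bit c b A) z = ins1 c b (place A z).
Proof. by case: c => //=; case: A => u v; rewrite place_square. Qed.

Lemma leaf_cover t z :
  exists i z', (i < num_leaves t)%N /\ z = place (leaf t i) z'.
Proof.
elim: t z => [|c l IHl r IHr] z; first by exists 0%N, z.
have [b [w ->]] := ins1_cover c z.
have [->|Eb] := eqVneq b (left_bit c).
  have [i [z' [lti ->]]] := IHl w; exists i, z'.
  by rewrite leaf_left // place_prefix_bit ltn_addr.
have [i [z' [lti ->]]] := IHr w; exists (num_leaves l + i)%N, z'.
rewrite leaf_right // place_prefix_bit ltn_add2l lti; split=> //.
by case: (b) (left_bit c) Eb => [] [].
Qed.

Lemma leaf_disjoint t i j z z' : (i < num_leaves t)%N -> (j < num_leaves t)%N ->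
  place (leaf t i) z = place (leaf t j) z' -> i = j.
Proof.
elim: t i j z z' => [|c l IHl r IHr] i j z z' /=; first by case: i j => [|?] [|?].
move=> lti ltj; rewrite !leaf_caret //.
case: (ltnP i) => hi; case: (ltnP j) => hj; rewrite !place_prefix_bit => /ins1_inj[].
- by move=> _; apply: IHl.
- by case: (left_bit c).
- by case: (left_bit c).
move=> _ /IHr; rewrite !ltn_subLR // => /(_ lti ltj) E.
by rewrite -(subnK hi) -(subnK hj) E.
Qed.

(** A descent in the tree uses fewer bits of either direction than there are leaves, so it ends at a
    leaf before [u] or [v] runs out. *)
Lemma address_extends_leaf t (u v : seq bool) :
  (num_leaves t <= size u)%N -> (num_leaves t <= size v)%N ->
  exists2 i, (i < num_leaves t)%N & exists C, (u, v) = cat_address (leaf t i) C.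
Proof.
elim: t u v => [|c l IHl r IHr] u v /=; first by exists 0%N => //; exists (u, v).
have l0 := num_leaves_gt0 l; have r0 := num_leaves_gt0 r.
move=> hu hv; case: c.
- case: u hu => [|b u] /= hu; first lia.
  case: b.
  + have [||i lti [C E]] := IHr u v; try lia.
    exists (num_leaves l + i)%N; first by rewrite ltn_add2l.
    by exists C; rewrite leaf_right // /cat_address /=; case: E => <- <-.
  + have [||i lti [C E]] := IHl u v; try lia.
    exists i; first by rewrite ltn_addr.
    by exists C; rewrite leaf_left // /cat_address /=; case: E => <- <-.
- case: v hv => [|b v] /= hv; first lia.
  case: b.
  + have [||i lti [C E]] := IHl u v; try lia.
    exists i; first by rewrite ltn_addr.
    by exists C; rewrite leaf_left // /cat_address /=; case: E => <- <-.
  + have [||i lti [C E]] := IHr u v; try lia.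
    exists (num_leaves l + i)%N; first by rewrite ltn_add2l.
    by exists C; rewrite leaf_right // /cat_address /=; case: E => <- <-.
Qed.

Lemma tree_pairP f S T s : num_leaves S = num_leaves T ->
  set_bij `I_(num_leaves S) `I_(num_leaves T) s ->
  tree_pair f S T s <->
  forall i, (i < num_leaves S)%N -> carries f (leaf S i) (leaf T (s i)).
Proof.
move=> eqn bij; split.
  by move=> [_ _ h] i lti; apply/carriesP; rewrite -!leaf_rectE; apply: h.
move=> h; split=> // i lti; rewrite !leaf_rectE; apply/carriesP; exact: h.
Qed.

Lemma tree_pair_carries f S T s i : tree_pair f S T s -> (i < num_leaves S)%N ->
  carries f (leaf S i) (leaf T (s i)).
Proof. by move=> h; have [eqn bij _] := h; move/(tree_pairP _ eqn bij): h; apply. Qed.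

Lemma tree_pair_bijective f S T s : tree_pair f S T s ->
  exists g, cancel f g /\ cancel g f.
Proof.
move=> h; have [eqn [sto sinj ssurj] _] := h.
have injf : injective f.
  move=> z z'; have [i [w [lti ->]]] := leaf_cover S z.
  have [j [w' [ltj ->]]] := leaf_cover S z'.
  rewrite !(tree_pair_carries h) // => E.
  have Es : s i = s j by apply: (leaf_disjoint (sto _ lti) (sto _ ltj) E).
  have Ei : i = j by apply: sinj => //; rewrite inE.
  by subst j; move/place_inj: E => ->.
have surj z : exists z', f z' = z.
  have [j [w [ltj ->]]] := leaf_cover T z.
  have [i lti <-] := ssurj j ltj.
  by exists (place (leaf S i) w); rewrite (tree_pair_carries h).
have [g gK] := choice surj; exists g; split=> //; exact: inj_can_sym.
Qed.

(** The generators are given only by predicates; this lemma supplies actual maps. *)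
Lemma tree_pair_exists S T s : num_leaves S = num_leaves T ->
  set_bij `I_(num_leaves S) `I_(num_leaves T) s -> exists f, tree_pair f S T s.
Proof.
move=> eqn bij.
have ex z : exists y, exists i z', [/\ (i < num_leaves S)%N,
    z = place (leaf S i) z' & y = place (leaf T (s i)) z'].
  by have [i [w [lti ->]]] := leaf_cover S z; exists (place (leaf T (s i)) w), i, w.
have [f hf] := choice ex; exists f; apply/(tree_pairP _ eqn bij) => i lti z.
have [j [w [ltj E ->]]] := hf (place (leaf S i) z).
by have Ei := leaf_disjoint lti ltj E; subst j; move/place_inj: E => ->.
Qed.

(** The value 4 is attained by [A_1], [B_1] and [Pi_1]; it is the origin of the 4 levels lost per
    letter. *)
Lemma generator_tree_pair f : generator f -> exists S T s,
  tree_pair f S T s /\ (num_leaves S <= 4)%N.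
Proof.
by move=> [i [hi]] [] h; do 3!eexists; split; try exact: h; case: hi => ->.
Qed.

Lemma letter_inverse f : letter f ->
  exists g, [/\ letter g, cancel f g & cancel g f].
Proof.
move=> [gf|[g [gg gK fK]]]; last by exists g; split=> //; left.
have [S [T [s [h _]]]] := generator_tree_pair gf.
have [g [fK gK]] := tree_pair_bijective h.
by exists g; split=> //; right; exists f.
Qed.

Definition reach n f := exists2 m, (m <= n)%N & product_of_letters m f.

Lemma reach_leq m n f : (m <= n)%N -> reach m f -> reach n f.
Proof. by move=> le [k lek hk]; exists k => //; exact: leq_trans le. Qed.

Lemma reach_id n : reach n id.
Proof. by exists 0%N => //; apply: product_nil. Qed.

Lemma reach_letter f : letter f -> reach 1 f.
Proof. by move=> h; exists 1%N => //; exact: (product_cons h (product_nil R)). Qed.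

Lemma reach_comp m n f g : reach m f -> reach n g -> reach (m + n) (f \o g).
Proof.
move=> [k lek hk] [l lel hl]; exists (k + l)%N; first exact: leq_add.
elim: hk {lek} => // {}k h e hh _ IH; exact: (product_cons hh IH).
Qed.

Lemma reach_inverse n f : reach n f -> exists g, [/\ reach n g, cancel f g & cancel g f].
Proof.
move=> [m lem hm].
suff [g [hg fK gK]] : exists g, [/\ reach m g, cancel f g & cancel g f].
  by exists g; split=> //; exact: reach_leq hg.
elim: hm {lem} => [|k h e hh _ [g [hg fK gK]]].
  by exists id; split=> //; exact: reach_id.
have [h' [lh' hK h'K]] := letter_inverse hh.
exists (g \o h'); split; [|exact: can_comp|exact: can_comp].
by rewrite -addn1; apply: reach_comp => //; exact: reach_letter.
Qed.

(** A word is evaluated on small cells; the results are reassembled here, provided that the images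
    are the two halves of one cell in the same direction and order. *)
Lemma carries_glue c f A B :
  carries f (cat_address A (prefix_bit c false ([::], [::])))
            (cat_address B (prefix_bit c false ([::], [::]))) ->
  carries f (cat_address A (prefix_bit c true ([::], [::])))
            (cat_address B (prefix_bit c true ([::], [::]))) ->
  carries f A B.
Proof.
move=> h0 h1 z; have [b [w ->]] := ins1_cover c z.
have E X : place X (ins1 c b w) = place (cat_address X (prefix_bit c b ([::], [::]))) w.
  by rewrite place_cat place_prefix_bit.
by rewrite !E; case: (b).
Qed.

Lemma set_bij_id n : set_bij `I_n `I_n id.
Proof. by split=> // i hi; exists i. Qed.

Lemma set_bij_exchange i n : (i.+1 < n)%N -> set_bij `I_n `I_n (exchange i).
Proof.
move=> lti.
have exK : involutive (exchange i).
  move=> k; rewrite /exchange /=.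
  have [->|ki] := eqVneq k i; first by rewrite eqxx ifN // gtn_eqF.
  by have [->|kj] := eqVneq k i.+1; rewrite ?eqxx // (negPf ki) (negPf kj).
have exI k : (k < n)%N -> (exchange i k < n)%N.
  rewrite /exchange /=; case: eqP => _ //; case: eqP => _ // _; exact: ltnW.
split=> //= [k l _ _ E|k hk]; first by rewrite -(exK k) E exK.
by exists (exchange i k); rewrite ?exK //=; exact: exI.
Qed.

End Trees.

(** * Flattening a tree into a comb *)

Section Generators.
Variable R : realType.
Notation sq := (usquare R).
Implicit Types (f g : sq -> sq) (z : sq) (A B C : address).

Let whole : address := ([::], [::]).
Definition hor (w : seq bool) : address := (w, [::]).
Notation O := false.
Notation I := true.

Lemma letter_exists S T s : num_leaves S = num_leaves T ->
  set_bij `I_(num_leaves S) `I_(num_leaves T) s ->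
  (forall f, tree_pair f S T s -> generator f) ->
  exists f, letter f /\
    forall i, (i < num_leaves S)%N -> carries f (leaf S i) (leaf T (s i)).
Proof.
move=> eqn bij gen; have [f h] := tree_pair_exists R eqn bij.
by exists f; split=> [|i]; [left; exact: gen | exact: tree_pair_carries].
Qed.

(** The letter is [A_0] or [B_0] according to [c]; [left_bit] lets one statement cover both. *)
Lemma exists_split0 c : exists f, letter f /\
  [/\ carries f (cat_address (hor [:: O]) (prefix_bit c (left_bit c) whole)) (hor [:: O]),
      carries f (cat_address (hor [:: O]) (prefix_bit c (~~ left_bit c) whole))
        (hor [:: I; O])
    & carries f (hor [:: I]) (hor [:: I; I])].
Proof.
have [|||f [lf h]] := @letter_exists
    (attach (Caret c Leaf Leaf) (right_tree 1) 0) (right_tree 2) id.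
- by [].
- exact: set_bij_id.
- by move=> f h; exists 0%N; split; [left | case: c h; [apply: Or41 | apply: Or42]].
exists f; split=> //; case: c h => h.
  by split; [exact: (h 0%N) | exact: (h 1%N) | exact: (h 2%N)].
by split; [exact: (h 0%N) | exact: (h 1%N) | exact: (h 2%N)].
Qed.

Lemma exists_split1 c : exists f, letter f /\
  [/\ carries f (hor [:: O]) (hor [:: O]),
      carries f (cat_address (hor [:: I; O]) (prefix_bit c (left_bit c) whole))
        (hor [:: I; O]),
      carries f (cat_address (hor [:: I; O]) (prefix_bit c (~~ left_bit c) whole))
        (hor [:: I; I; O])
    & carries f (hor [:: I; I]) (hor [:: I; I; I])].
Proof.
have [|||f [lf h]] := @letter_exists
    (attach (Caret c Leaf Leaf) (right_tree 2) 1) (right_tree 3) id.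
- by [].
- exact: set_bij_id.
- by move=> f h; exists 1%N; split; [right | case: c h; [apply: Or41 | apply: Or42]].
exists f; split=> //; case: c h => h.
  by split; [exact: (h 0%N) | exact: (h 1%N) | exact: (h 2%N) | exact: (h 3)].
by split; [exact: (h 0%N) | exact: (h 1%N) | exact: (h 2%N) | exact: (h 3)].
Qed.

Lemma exists_Pi0 : exists f, letter f /\
  [/\ carries f (hor [:: O]) (hor [:: I; O]),
      carries f (hor [:: I; O]) (hor [:: O])
    & carries f (hor [:: I; I]) (hor [:: I; I])].
Proof.
have [|||f [lf h]] := @letter_exists (right_tree 2) (right_tree 2) (exchange 0).
- by [].
- exact: set_bij_exchange.
- by move=> f h; exists 0%N; split; [left | apply: Or43].
by exists f; do 2!split=> //; [exact: (h 0%N) | exact: (h 1%N) | exact: (h 2%N)].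
Qed.

Lemma exists_Pi1 : exists f, letter f /\
  [/\ carries f (hor [:: O]) (hor [:: O]),
      carries f (hor [:: I; O]) (hor [:: I; I; O]),
      carries f (hor [:: I; I; O]) (hor [:: I; O])
    & carries f (hor [:: I; I; I]) (hor [:: I; I; I])].
Proof.
have [|||f [lf h]] := @letter_exists (right_tree 3) (right_tree 3) (exchange 1).
- by [].
- exact: set_bij_exchange.
- by move=> f h; exists 1%N; split; [right | apply: Or43].
by exists f; do 2!split=> //;
  [exact: (h 0%N) | exact: (h 1%N) | exact: (h 2%N) | exact: (h 3)].
Qed.

Lemma exists_Pibar0 : exists f, letter f /\
  carries f (hor [:: O]) (hor [:: I]) /\ carries f (hor [:: I]) (hor [:: O]).
Proof.
have [|||f [lf h]] := @letter_exists (right_tree 1) (right_tree 1) (exchange 0).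
- by [].
- exact: set_bij_exchange.
- by move=> f h; exists 0%N; split; [left | apply: Or44].
by exists f; do 2!split=> //; [exact: (h 0%N) | exact: (h 1%N)].
Qed.

Lemma exists_Pibar1 : exists f, letter f /\
  [/\ carries f (hor [:: O]) (hor [:: O]),
      carries f (hor [:: I; O]) (hor [:: I; I])
    & carries f (hor [:: I; I]) (hor [:: I; O])].
Proof.
have [|||f [lf h]] := @letter_exists (right_tree 2) (right_tree 2) (exchange 1).
- by [].
- exact: set_bij_exchange.
- by move=> f h; exists 1%N; split; [right | apply: Or44].
by exists f; do 2!split=> //; [exact: (h 0%N) | exact: (h 1%N) | exact: (h 2%N)].
Qed.

Lemma exists_A0_inverse : exists g, letter g /\
  [/\ carries g (hor [:: O]) (hor [:: O; O]),
      carries g (hor [:: I; O]) (hor [:: O; I])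
    & carries g (hor [:: I; I]) (hor [:: I])].
Proof.
have [f [lf [f0 f1 f2]]] := exists_split0 Triangular.
have [g [lg fK _]] := letter_inverse lf.
by exists g; split=> //; split; apply: carries_inv fK _.
Qed.

(* B_0 and B_1 only halve a cell that has another cell on its right, hence the
   separate words for a horizontal halving of the rightmost cell. *)
Lemma exists_last_split0 c : exists2 f : sq -> sq, reach 5 f &
  carries f (prefix_bit c (left_bit c) whole) (hor [:: O]) /\
  carries f (prefix_bit c (~~ left_bit c) whole) (hor [:: I]).
Proof.
case: c; first by exists (@id sq); [exact: reach_id | split].
have [b0 [lb0 [b00 b01 b02]]] := exists_split0 Square.
have [b1 [lb1 [b10 b11 b12 b13]]] := exists_split1 Square.
have [p [lp [p0 p1 p2]]] := exists_Pibar1.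
have [a [la [a0 a1 a2]]] := exists_A0_inverse.
(* [B_0] halves the left column, a swap brings the right column to the cone 10, and [B_1] halves it
   there. [A_0^-1] gathers the two upper quarters under 0, and the last swap puts the lower quarters
   in order. *)
exists (p \o (a \o (b1 \o (p \o b0)))).
  by do 4!(apply: (reach_comp (m := 1)); [exact: reach_letter|]); exact: reach_letter.
split; apply: (carries_glue (c := Triangular)) => z /=.
- by rewrite b00 p0 b10 a0 p0.
- by rewrite b02 p2 b11 a1 p0.
- by rewrite b01 p1 b13 a2 p2.
- by rewrite b02 p2 b12 a2 p1.
Qed.

Lemma exists_last_split1 c : exists2 f : sq -> sq, reach 9 f &
  [/\ carries f (hor [:: O]) (hor [:: O]),
      carries f (cat_address (hor [:: I]) (prefix_bit c (left_bit c) whole))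
        (hor [:: I; O])
    & carries f (cat_address (hor [:: I]) (prefix_bit c (~~ left_bit c) whole))
        (hor [:: I; I])].
Proof.
case: c; first by exists (@id sq); [exact: reach_id | split].
have [b [lb [b0 b1 b2 b3]]] := exists_split1 Square.
have [p [lp [p0 p1 p2]]] := exists_Pibar1.
have [a0 [la0 [a00 a01 a02]]] := exists_split0 Triangular.
have [a0' [la0' [a00' a01' a02']]] := exists_A0_inverse.
have [a1 [la1 [a10 a11 a12 a13]]] := exists_split1 Triangular.
have [a1' [la1' a1K _]] := letter_inverse la1.
have a10' := carries_inv a1K a10; have a11' := carries_inv a1K a11.
have a12' := carries_inv a1K a12; have a13' := carries_inv a1K a13.
(* The five-letter word of [exists_last_split0] with all indices raised by one: conjugation by [A_0]
   turns [B_1] and [Pibar_1] into the maps of index 2. *)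
exists (a0 \o (p \o (a0' \o (a1' \o (a0 \o (b \o (p \o (a0' \o b)))))))).
  by do 8!(apply: (reach_comp (m := 1)); [exact: reach_letter|]); exact: reach_letter.
split=> [z /=||].
- by rewrite b0 a00' p0 b0 a00 a10' a00' p0 a00.
- apply: (carries_glue (c := Triangular)) => z /=.
  + by rewrite b1 a01' p0 b0 a01 a11' a01' p0 a01.
  + by rewrite b3 a02' p2 b1 a02 a12' a01' p0 a01.
- apply: (carries_glue (c := Triangular)) => z /=.
  + by rewrite b2 a02' p1 b3 a02 a13' a02' p2 a02.
  + by rewrite b3 a02' p2 b2 a02 a13' a02' p1 a02.
Qed.

Lemma place_prefix_cat A c b B z : place (cat_address A (prefix_bit c b B)) z =
  place (cat_address A (prefix_bit c b whole)) (place B z).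
Proof. by rewrite !place_cat !place_prefix_bit. Qed.

Lemma place_hor_cat u v z : place (hor (u ++ v)) z = place (hor u) (place (hor v) z).
Proof. by rewrite -place_cat. Qed.

Lemma nseq_rcons_split m k : (0 < k)%N ->
  nseq m.+1 O ++ rcons (nseq k.-1 O) I = rcons (nseq (m + k) O) I.
Proof. by move=> k0; rewrite -rcons_cat -nseqD; congr (rcons (nseq _ _) _); lia. Qed.

(* These maps flatten S, whose leaves become teeth of a comb in
   left-to-right order. Composing each of Brin's shifted generators with a
   conjugating power of A_0 would cost quadratically many letters; here every
   leaf shifts the whole picture once by A_0^-1, so that only generators of
   index at most 1 are needed. *)
Lemma comb_inner S : exists2 f : sq -> sq, reach (2 * num_leaves S).-1 f &
  [/\ carries f (hor [:: O]) (hor (nseq (num_leaves S).+1 O)),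
      carries f (hor [:: I; I]) (hor [:: I])
    & forall j, (j < num_leaves S)%N ->
        carries f (cat_address (hor [:: I; O]) (leaf S j))
          (hor (rcons (nseq (num_leaves S - j) O) I))].
Proof.
elim: S => [|c l [fl hl [l0 l2 l1]] r [fr hr [r0 r2 r1]]] /=.
  have [a [la [a0 a1 a2]]] := exists_A0_inverse.
  (* [A_0^-1] adds the leaf to the comb growing under 0 and lets all that follows fill the right
     half. *)
  exists a; first by apply: reach_leq (reach_letter la).
  by split=> // -[|//] _ z; rewrite -a1.
have [s [ls [s0 s1 s2 s3]]] := exists_split1 c.
have gl := num_leaves_gt0 l; have gr := num_leaves_gt0 r.
exists (fr \o (fl \o s)).
  apply: reach_leq (reach_comp hr (reach_comp hl (reach_letter ls))).
  lia.
split=> [z|z|j ltj z] /=.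
- rewrite s0 l0 (place_hor_cat [:: O] (nseq _ O)) r0 -place_hor_cat -nseqD.
  by rewrite addSn addnC.
- by rewrite s3 l2 r2.
rewrite leaf_caret //; case: (ltnP j) => hj; rewrite place_prefix_cat.
- rewrite s1 -place_cat l1 //.
  have [k Ek] : exists k, (num_leaves l - j)%N = k.+1 by exists (num_leaves l - j).-1; lia.
  rewrite Ek (place_hor_cat [:: O] (rcons (nseq k O) I)) r0 -place_hor_cat.
  rewrite (nseq_rcons_split _ (ltn0Sn k)).
  by have -> : (num_leaves l + num_leaves r - j = num_leaves r + k.+1)%N by lia.
- rewrite s2 (place_hor_cat [:: I; I] [:: O]) l2 -place_cat r1; last lia.
  by have -> : (num_leaves l + num_leaves r - j = num_leaves r - (j - num_leaves l))%N by lia.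
Qed.

(** At the left edge no comb exists yet, and the first leaf becomes its deepest cone. Only the left
    child stays at the edge; the right child falls under [comb_inner]. *)
Lemma comb_left S : exists2 f : sq -> sq, reach (2 * num_leaves S) f &
  [/\ carries f (hor [:: I]) (hor [:: I]),
      carries f (cat_address (hor [:: O]) (leaf S 0)) (hor (nseq (num_leaves S) O))
    & forall j, (0 < j < num_leaves S)%N ->
        carries f (cat_address (hor [:: O]) (leaf S j))
          (hor (rcons (nseq (num_leaves S - j) O) I))].
Proof.
elim: S => [|c l [fl hl [l1 l0 lj]] r _] /=.
  by exists (@id sq); [exact: reach_id | split=> // -[]].
have [fr hr [r0 r2 r1]] := comb_inner r.
have [s [ls [s0 s1 s2]]] := exists_split0 c.
have gl := num_leaves_gt0 l; have gr := num_leaves_gt0 r.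
exists (fr \o (fl \o s)).
  by apply: reach_leq (reach_comp hr (reach_comp hl (reach_letter ls))); lia.
split=> [z|z|j ltj z] /=.
- by rewrite s2 (place_hor_cat [:: I] [:: I]) l1 -place_hor_cat r2.
- rewrite leaf_left // place_prefix_cat s0 -place_cat l0.
  have [k Ek] : exists k, num_leaves l = k.+1 by exists (num_leaves l).-1; lia.
  rewrite Ek (place_hor_cat [:: O] (nseq k O)) r0 -place_hor_cat -nseqD.
  by have -> : (k.+1 + num_leaves r = (num_leaves r).+1 + k)%N by lia.
- rewrite leaf_caret; last lia.
  case: (ltnP j) => hj; rewrite place_prefix_cat.
  + rewrite s0 -place_cat lj; last lia.
    have [k Ek] : exists k, (num_leaves l - j)%N = k.+1 by exists (num_leaves l - j).-1; lia.
    rewrite Ek (place_hor_cat [:: O] (rcons (nseq k O) I)) r0 -place_hor_cat.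
    rewrite (nseq_rcons_split _ (ltn0Sn k)).
    by have -> : (num_leaves l + num_leaves r - j = num_leaves r + k.+1)%N by lia.
  + rewrite s1 (place_hor_cat [:: I] [:: O]) l1 -place_hor_cat -place_cat r1; last lia.
    by have -> : (num_leaves l + num_leaves r - j = num_leaves r - (j - num_leaves l))%N by lia.
Qed.

(** Carets on the right edge have no cell to their right and cost up to 9 letters each. Together
    with the 2 letters per leaf of the left child, this stays below 11 per leaf. *)
Lemma comb_right S : exists2 f : sq -> sq, reach (11 * num_leaves S) f &
  carries f (hor [:: O]) (hor (nseq (num_leaves S) O)) /\
  forall j, (j < num_leaves S)%N ->
    carries f (cat_address (hor [:: I]) (leaf S j))
      (hor (rcons (nseq ((num_leaves S).-1 - j) O) I)).
Proof.
elim: S => [|c l _ r [fr hr [r0 r1]]] /=.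
  by exists (@id sq); [exact: reach_id | split=> // -[]].
have [fl hl [l0 l2 l1]] := comb_inner l.
have [s hs [s0 s1 s2]] := exists_last_split1 c.
have gl := num_leaves_gt0 l; have gr := num_leaves_gt0 r.
exists (fr \o (fl \o s)).
  by apply: reach_leq (reach_comp hr (reach_comp hl hs)); lia.
split=> [z|j ltj z] /=.
- rewrite s0 l0 (place_hor_cat [:: O] (nseq _ O)) r0 -place_hor_cat -nseqD.
  by rewrite addnC.
rewrite leaf_caret //; case: (ltnP j) => hj; rewrite place_prefix_cat.
- rewrite s1 -place_cat l1 //.
  have [k Ek] : exists k, (num_leaves l - j)%N = k.+1 by exists (num_leaves l - j).-1; lia.
  rewrite Ek (place_hor_cat [:: O] (rcons (nseq k O) I)) r0 -place_hor_cat.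
  rewrite -(prednK gr) (nseq_rcons_split _ (ltn0Sn k)).
  by have -> : ((num_leaves l + (num_leaves r).-1.+1).-1 - j = (num_leaves r).-1 + k.+1)%N by lia.
- rewrite s2 l2 -place_cat r1; last lia.
  by have -> : ((num_leaves l + num_leaves r).-1 - j
    = (num_leaves r).-1 - (j - num_leaves l))%N by lia.
Qed.

(* In the left comb with n leaves, leaf 0 is the cone 0^(n-1) and leaf j > 0 is
   the cone 0^(n-1-j) 1. *)
Definition comb_leaf (n j : nat) : address :=
  hor (if j is j'.+1 then rcons (nseq (n.-1 - j) O) I else nseq n.-1 O).

Lemma comb_reach S : exists2 f : sq -> sq, reach (11 * num_leaves S) f &
  forall j, (j < num_leaves S)%N -> carries f (leaf S j) (comb_leaf (num_leaves S) j).
Proof.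
case: S => [|c l r] /=.
  by exists (@id sq); [exact: reach_id | case].
have [fr hr [r0 r1]] := comb_right r.
have [fl hl [l1 l0 lj]] := comb_left l.
have [s hs [s0 s1]] := exists_last_split0 c.
have gl := num_leaves_gt0 l; have gr := num_leaves_gt0 r.
exists (fr \o (fl \o s)).
  by apply: reach_leq (reach_comp hr (reach_comp hl hs)); lia.
move=> j ltj z /=.
have split_root b B w : place (prefix_bit c b B) w = place (prefix_bit c b whole) (place B w).
  by rewrite !place_prefix_bit.
rewrite leaf_caret // /comb_leaf; case: (ltnP j) => hj; rewrite split_root.
- rewrite s0 -place_cat; case: j hj ltj => [|j] hj ltj.
    rewrite l0.
    have [k Ek] : exists k, num_leaves l = k.+1 by exists (num_leaves l).-1; lia.
    rewrite Ek (place_hor_cat [:: O] (nseq k O)) r0 -place_hor_cat -nseqD.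
    by have -> : ((k.+1 + num_leaves r).-1 = num_leaves r + k)%N by lia.
  rewrite lj //.
  have [k Ek] : exists k, (num_leaves l - j.+1)%N = k.+1 by exists (num_leaves l - j.+1).-1; lia.
  rewrite Ek (place_hor_cat [:: O] (rcons (nseq k O) I)) r0 -place_hor_cat.
  rewrite -(prednK gr) (nseq_rcons_split _ (ltn0Sn k)).
  by have -> : ((num_leaves l + (num_leaves r).-1.+1).-1 - j.+1
    = (num_leaves r).-1 + k.+1)%N by lia.
- case: j hj ltj => [|j] hj ltj; first lia.
  rewrite s1 l1 -place_cat r1; last lia.
  by have -> : ((num_leaves l + num_leaves r).-1 - j.+1
    = (num_leaves r).-1 - (j.+1 - num_leaves l))%N by lia.
Qed.

(** Both trees flatten to the same comb, at 11 letters per leaf each. *)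
Lemma retree_reach S T : num_leaves S = num_leaves T ->
  exists2 f : sq -> sq, reach (22 * num_leaves S) f &
    forall j, (j < num_leaves S)%N -> carries f (leaf S j) (leaf T j).
Proof.
move=> eqn; have [f hf fS] := comb_reach S.
have [g hg gT] := comb_reach T; have [g' [hg' gK _]] := reach_inverse hg.
exists (g' \o f); first by apply: reach_leq (reach_comp hg' hf); lia.
move=> j ltj; apply: carries_comp (fS _ ltj) _; apply: carries_inv gK _.
by rewrite eqn; apply: gT; rewrite -eqn.
Qed.

End Generators.

(** * Permutations of the leaves of a balanced tree *)

Section Permutations.
Variable R : realType.
Notation sq := (usquare R).
Implicit Types (f g : sq -> sq) (z : sq) (A B C : address).
Notation O := false.
Notation I := true.

Definition swaps f A B := [/\ carries f A B, carries f B A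
  & forall z, (forall w, z <> place A w) -> (forall w, z <> place B w) -> f z = z].

Lemma cover3 z : exists w, [\/ z = place (hor [:: O]) w,
  z = place (hor [:: I; O]) w | z = place (hor [:: I; I]) w].
Proof.
have [[] [z' ->]] := ins1_cover Triangular z; last first.
  by exists z'; apply: Or31.
have [[] [w ->]] := ins1_cover Triangular z'; exists w; first exact: Or33.
exact: Or32.
Qed.

(* Conjugating Pi_0, which swaps the cones 0 and 10. *)
Lemma swaps_reach n (h : sq -> sq) A : reach n h -> carries h (hor [:: O]) (hor [:: O]) ->
  carries h A (hor [:: I; O]) ->
  exists2 f : sq -> sq, reach (2 * n).+1 f & swaps f (hor [:: O]) A.
Proof.
move=> hn h0 hA; have [h' [hn' hK h'K]] := reach_inverse hn.
have [p [lp [p0 p1 p2]]] := exists_Pi0 R.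
have h'0 := carries_inv hK h0; have h'A := carries_inv hK hA.
exists (h' \o (p \o h)).
  by apply: reach_leq (reach_comp hn' (reach_comp (reach_letter lp) hn)); lia.
split=> [z|z|z n0 nA] /=.
- by rewrite h0 p0 h'A.
- by rewrite hA p1 h'0.
have [w [E|E|E]] := cover3 (h z).
- by case: (n0 w); rewrite -(hK z) E h'0.
- by case: (nA w); rewrite -(hK z) E h'A.
- by rewrite E p2 -E hK.
Qed.

(** The cone 10w is contracted to 10 one bit at a time, fixing the cone 0: [A_1] removes a bit, and
    [Pi_1] follows if the bit was true. These 2 letters per bit count twice in the conjugation. *)
Lemma swaps_cone_reach w :
  exists2 f : sq -> sq, reach (4 * size w).+1 f & swaps f (hor [:: O]) (hor ([:: I; O] ++ w)).
Proof.
suff [h hn [h0 hw]] : exists2 h : sq -> sq, reach (2 * size w) h &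
    carries h (hor [:: O]) (hor [:: O]) /\ carries h (hor ([:: I; O] ++ w)) (hor [:: I; O]).
  have [f hf sf] := swaps_reach hn h0 hw; exists f => //.
  by apply: reach_leq hf; lia.
elim: w => [|b w [h hn [h0 hw]]].
  by exists (@id sq); [exact: reach_id | split].
have [a ha [a0 ab]] : exists2 a : sq -> sq, reach 2 a & carries a (hor [:: O]) (hor [:: O])
    /\ carries a (hor [:: I; O; b]) (hor [:: I; O]).
  have [s [ls [s0 s1 s2 s3]]] := exists_split1 R Triangular.
  case: b; last by exists s; [exact: reach_leq (reach_letter ls) | split].
  have [p [lp [p0 p1 p2 p3]]] := exists_Pi1 R.
  exists (p \o s); first exact: (reach_comp (reach_letter lp) (reach_letter ls)).
  by split; [exact: carries_comp s0 p0 | exact: carries_comp s2 p2].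
exists (h \o a); first by apply: reach_leq (reach_comp hn ha); rewrite /=; lia.
split; first exact: carries_comp a0 h0.
move=> z /=; rewrite (place_hor_cat [:: I; O; b] w) ab -place_hor_cat; exact: hw.
Qed.

Section Realize.
Variables (n : nat) (cell : 'I_n.+1 -> address).

Definition realizes k (s : 'S_n.+1) :=
  exists2 f : sq -> sq, reach k f & forall i, carries f (cell i) (cell (s i)).

Lemma realizes1 k : realizes k 1%g.
Proof. by exists id => [|i]; [exact: reach_id | rewrite perm1]. Qed.

Lemma realizesM k l s t : realizes k s -> realizes l t -> realizes (k + l) (s * t)%g.
Proof.
move=> [f hf fs] [g hg gt]; exists (g \o f); first by rewrite addnC; exact: reach_comp.
by move=> i; rewrite permM; apply: carries_comp (fs i) (gt _).
Qed.

Lemma realizes_leq k l s : (k <= l)%N -> realizes k s -> realizes l s.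
Proof. by move=> le [f hf fs]; exists f => //; exact: reach_leq hf. Qed.

Variable k : nat.
Hypothesis star : forall i, realizes k (tperm ord0 i).

Lemma realizes_tperm i j : realizes (3 * k) (tperm i j).
Proof.
have [->|ni] := eqVneq i ord0; first by apply: realizes_leq (star j); lia.
have [->|nj] := eqVneq j ord0.
  by rewrite tpermC; apply: realizes_leq (star i); lia.
have [->|nij] := eqVneq i j; first by rewrite tperm1; exact: realizes1.
have -> : tperm i j = (tperm ord0 i * (tperm ord0 j * tperm ord0 i))%g.
  have := tpermJ ord0 j (tperm ord0 i); rewrite tpermL tpermD ?(eq_sym ord0) // => <-.
  by rewrite /conjg tpermV.
by apply: realizes_leq (realizesM (star i) (realizesM (star j) (star i))); lia.
Qed.

(** One transposition settles the largest index that may move; what remains is a permutation of the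
    smaller ones. *)
Lemma realizes_perm s : realizes (n.+1 * (3 * k)) s.
Proof.
suff fixed m : (m <= n.+1)%N -> forall s : 'S_n.+1,
    (forall i : 'I_n.+1, (m <= i)%N -> s i = i) -> realizes (m * (3 * k)) s.
  by apply: fixed => // i; rewrite leqNgt ltn_ord.
elim: m => [|m IH] lem t ft.
  suff -> : t = 1%g by exact: realizes1.
  by apply/permP => i; rewrite ft // perm1.
pose i0 := Ordinal lem; rewrite -(mulgKV (tperm (t i0) i0) t) tpermV.
rewrite mulSn addnC; apply: realizesM (realizes_tperm _ _).
apply: IH => [|i lei]; first exact: ltnW.
rewrite permM; have [->|ni] := eqVneq i i0; first by rewrite tpermL.
have lti : (m < i)%N by rewrite ltn_neqAle lei andbT eq_sym.
rewrite (ft i lti) tpermD // 1?eq_sym //.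
by apply: contraNneq ni => E; apply/eqP/(@perm_inj _ t); rewrite (ft i lti).
Qed.

End Realize.

Lemma swaps_realizes n (cell : 'I_n.+1 -> address) k f i :
  (forall j l z w, place (cell j) z = place (cell l) w :> sq -> j = l) ->
  reach k f -> swaps f (cell ord0) (cell i) -> realizes cell k (tperm ord0 i).
Proof.
move=> disj hf [f0 fi fix_]; exists f => // j.
case: tpermP => [-> //|-> //|/eqP n0 /eqP ni] z.
by apply: fix_ => w /disj E; [move: n0 | move: ni]; rewrite E eqxx.
Qed.

Lemma balanced_tree d n : (0 < n <= 2 ^ d)%N -> exists t, num_leaves t = n /\
  forall A, A \in leaves t -> exists2 w, (size w <= d)%N & A = hor w.
Proof.
elim: d n => [|d IH] n hn.
  exists Leaf; split; first by move: hn; rewrite expn0 /=; lia.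
  by move=> A; rewrite inE => /eqP ->; exists [::].
have [n1|n1] := leqP n 1.
  exists Leaf; split; first by rewrite /=; lia.
  by move=> A; rewrite inE => /eqP ->; exists [::].
move: hn; rewrite expnS => hn.
have [|l [El hl]] := IH n./2; first by lia.
have [|r [Er hr]] := IH (n - n./2)%N; first by lia.
exists (Caret Triangular l r); split; first by rewrite /= El Er; lia.
move=> A /=; rewrite mem_cat => /orP[] /mapP[B].
  by move=> /hl[w lew ->] ->; exists (O :: w).
by move=> /hr[w lew ->] ->; exists (I :: w).
Qed.

Lemma leaf_mem t i : (i < num_leaves t)%N -> leaf t i \in leaves t.
Proof. by move=> lti; rewrite mem_nth // size_leaves. Qed.

(** Leaf 0 is the cone 0, a balanced tree hangs at 10, and a last leaf occupies 11, so that [A_1]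
    always finds a cell to the right of 10. The two extra leaves explain the 2 in the hypothesis;
    fewer than three leaves are treated apart. *)
Lemma star_tree n d : (n.+1 <= 2 ^ d + 2)%N -> exists t, num_leaves t = n.+1 /\
  forall i : 'I_n.+1, realizes (fun j : 'I_n.+1 => leaf t j) (4 * d + 3)%N (tperm ord0 i).
Proof.
move=> len.
suff [t [Et ht]] : exists t, num_leaves t = n.+1 /\ forall i, (0 < i < n.+1)%N ->
    exists2 f : sq -> sq, reach (4 * d + 3) f & swaps f (leaf t 0) (leaf t i).
  exists t; split=> // i.
  have [->|ni] := eqVneq i ord0; first by rewrite tperm1; exact: realizes1.
  have [|f hf sf] := ht i; first by rewrite ltn_ord lt0n andbT.
  apply: swaps_realizes hf sf => j l z w E; apply: val_inj => /=.
  by apply: leaf_disjoint E; rewrite Et.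
case: n len => [|[|n]] len.
- by exists Leaf; split=> // -[].
- exists (Caret Triangular Leaf Leaf); split=> // -[|[|//]] // _.
  have [p [lp [p0 p1]]] := exists_Pibar0 R.
  exists p; first by apply: reach_leq (reach_letter lp); lia.
  split=> // z n0 n1; have [[] [w E]] := ins1_cover Triangular z.
    by case: (n1 w).
  by case: (n0 w).
have [|t [Et ht]] := @balanced_tree d n.+1; first by lia.
exists (Caret Triangular Leaf (Caret Triangular t Leaf)).
split=> [|i hi]; first by rewrite /= Et; lia.
have [->|ni] := eqVneq i n.+2.
  have -> : leaf (Caret Triangular Leaf (Caret Triangular t Leaf)) n.+2 = hor [:: I; I].
    rewrite (@leaf_right Triangular Leaf _ n.+1) /=; last by rewrite Et; lia.
    by have := @leaf_right Triangular t Leaf 0 isT; rewrite Et addn0 => ->.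
  have [p [lp [p0 p1 p2]]] := exists_Pibar1 R.
  have [f hf sf] := swaps_reach (reach_letter lp) p0 p2.
  by exists f => //; apply: reach_leq hf; lia.
have [w lew Ew] : exists2 w, (size w <= d)%N & leaf t i.-1 = hor w.
  by apply: ht; apply: leaf_mem; rewrite Et; lia.
have -> : leaf (Caret Triangular Leaf (Caret Triangular t Leaf)) i = hor ([:: I; O] ++ w).
  case: i hi ni Ew => [|i] //= hi ni Ew.
  rewrite (@leaf_right Triangular Leaf _ i) /=; last by rewrite Et; lia.
  by rewrite leaf_left ?Ew //; rewrite Et; lia.
have [f hf sf] := swaps_cone_reach w; exists f => //.
by apply: reach_leq hf; lia.
Qed.

Lemma tree_pair_reach d S T f : num_leaves S = num_leaves T ->
  (num_leaves S <= 2 ^ d + 2)%N -> injective f ->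
  (forall i, (i < num_leaves S)%N -> exists2 j, (j < num_leaves T)%N &
     carries f (leaf S i) (leaf T j)) ->
  reach (num_leaves S * (12 * d + 53)) f.
Proof.
move=> eqn len injf fST.
have [n En] : exists n, num_leaves S = n.+1.
  by exists (num_leaves S).-1; rewrite prednK // num_leaves_gt0.
have ex (i : 'I_n.+1) : exists j : 'I_n.+1, carries f (leaf S i) (leaf T j).
  have [|j ltj c] := fST i; first by rewrite En.
  by rewrite -eqn En in ltj; exists (Ordinal ltj).
have [s hs] := choice ex.
have injs : injective s.
  move=> i j E; apply: val_inj; have := hs i (origin R); have := hs j (origin R).
  by rewrite E => <- /injf; apply: leaf_disjoint; rewrite En.
have [|t [Et star]] := @star_tree n d; first by rewrite -En.
have [g hg gp] := realizes_perm star (perm injs).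
have [h hh hS] : exists2 h : sq -> sq, reach (22 * num_leaves S) h &
    forall j, (j < num_leaves S)%N -> carries h (leaf S j) (leaf t j).
  by apply: retree_reach; rewrite Et.
have [h' hh' hT] : exists2 h : sq -> sq, reach (22 * num_leaves T) h &
    forall j, (j < num_leaves T)%N -> carries h (leaf T j) (leaf t j).
  by apply: retree_reach; rewrite Et -eqn.
have [k [hk h'K kK]] := reach_inverse hh'.
have -> : f = k \o (g \o h).
  apply/funext => z; have [i [w [lti ->]]] := leaf_cover S z.
  rewrite /= hS //; rewrite En in lti.
  have := gp (Ordinal lti) w; rewrite /= => ->; rewrite permE.
  have := hs (Ordinal lti) w => /= ->.
  by rewrite (carries_inv h'K (hT _ _)) // -eqn En.
(* Per leaf: 22 letters for each change of tree and 3(4d + 3) for the permutation, 12d + 53 in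
   all. *)
apply: reach_leq (reach_comp hk (reach_comp hg hh)).
rewrite -eqn En; nia.
Qed.

End Permutations.

(** * Partitions and grid diagrams *)

Section Partitions.
Variable R : realType.
Notation sq := (usquare R).
Implicit Types (f x : sq -> sq) (z : sq) (A B C : address) (Q : seq address).

Lemma leaves_cover t z : exists2 A, A \in leaves t & exists w, z = place A w.
Proof.
have [i [w [lti ->]]] := leaf_cover t z.
by exists (leaf t i); [exact: leaf_mem | exists w].
Qed.

Lemma leaves_disjoint t A B (z w : sq) : A \in leaves t -> B \in leaves t ->
  place A z = place B w -> A = B.
Proof.
move=> /(nthP ([::], [::]))[i lti <-] /(nthP ([::], [::]))[j ltj <-].
by rewrite size_leaves in lti; rewrite size_leaves in ltj => /(leaf_disjoint lti ltj) ->.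
Qed.

Lemma prefix_bit_inj c b : injective (prefix_bit c b).
Proof. by case: c => -[u v] [u' v'] /= [-> ->]. Qed.

Lemma leaves_uniq t : uniq (leaves t).
Proof.
elim: t => //= c l IHl r IHr.
rewrite cat_uniq !map_inj_uniq ?IHl ?IHr ?andbT //=; try exact: prefix_bit_inj.
apply/hasPn => _ /mapP[A _ ->]; apply/mapP => -[B _].
by case: c => /= -[].
Qed.

Definition rect_partition Q := [/\ uniq Q,
  forall z, exists2 A, A \in Q & exists w, z = place A w
  & forall A B (z w : sq), A \in Q -> B \in Q -> place A z = place B w -> A = B].

Definition strip c A : address :=
  if c is Triangular then (behead A.1, A.2) else (A.1, behead A.2).

(** The filter tests that the first bit of [A] in direction [c] exists and equals [b]. *)
Definition subpartition c b Q :=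
  [seq strip c A | A <- Q & prefix_bit c b (strip c A) == A].

Lemma prefix_bitK c b : cancel (prefix_bit c b) (strip c).
Proof. by case: c => -[]. Qed.

Lemma mem_subpartition c b Q A :
  (A \in subpartition c b Q) = (prefix_bit c b A \in Q).
Proof.
apply/mapP/idP => [[B]|hA].
  by rewrite mem_filter => /andP[/eqP EB hB] ->; rewrite EB.
by exists (prefix_bit c b A); rewrite ?mem_filter prefix_bitK // eqxx.
Qed.

Lemma subpartition_partition c b Q : rect_partition Q ->
  (forall A, A \in Q -> exists b B, A = prefix_bit c b B) ->
  rect_partition (subpartition c b Q).
Proof.
move=> [uQ cover disj] pQ; split.
- rewrite map_inj_in_uniq ?filter_uniq // => A B; rewrite !mem_filter.
  by move=> /andP[/eqP EA _] /andP[/eqP EB _] E; rewrite -EA -EB E.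
- move=> z; have [A hA [w E]] := cover (ins1 c b z).
  have [b' [B EA]] := pQ _ hA; move: E; rewrite EA place_prefix_bit => /ins1_inj[Eb ->].
  by exists B; [rewrite mem_subpartition Eb -EA | exists w].
move=> A B z w; rewrite !mem_subpartition => hA hB E.
apply: (@prefix_bit_inj c b); apply: (disj _ _ z w hA hB).
by rewrite !place_prefix_bit E.
Qed.

(* A cell spanning the full width and a cell spanning the full height meet, so
   one of the two middle segments of the square crosses no cell. *)
Lemma partition_split Q : rect_partition Q -> ([::], [::]) \notin Q ->
  exists c, forall A, A \in Q -> exists b B, A = prefix_bit c b B.
Proof.
move=> [_ _ disj] n0.
have [nT|/allPn[[u v] hA /negPn/eqP /= Eu]] := boolP (all (fun A => A.1 != [::]) Q).
  by exists Triangular => -[[|b u] v] /(allP nT) // _; exists b, (u, v).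
subst u; exists Square => -[u [|b v']] hB; last by exists b, (u, v').
case/negP: n0; have E : ([::], v) = (u, [::]) :> address.
  apply: (disj _ _ (place (u, [::]) (origin R)) (place ([::], v) (origin R))) => //.
  by rewrite -!place_cat /cat_address /= !cats0.
by case: E => _ Ev; move: hA; rewrite Ev.
Qed.

Lemma guillotine Q : rect_partition Q -> exists t, leaves t =i Q.
Proof.
have [n] := ubnP (size Q); elim: n Q => // n IH Q ltn pQ; have [uQ cover disj] := pQ.
have [h0|n0] := boolP (([::], [::]) \in Q).
  exists Leaf => A; rewrite inE; apply/eqP/idP => [-> //|hA].
  by apply: (disj _ _ (origin R) (place A (origin R))).
have [c pc] := partition_split pQ n0.
have proper b : (size (subpartition c b Q) < size Q)%N.
  rewrite size_map size_filter ltn_neqAle count_size andbT -all_count.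
  (* Some cell contains a point of the opposite half, and this cell is filtered out. *)
  have [A hA [w E]] := cover (ins1 c (~~ b) (origin R)).
  apply/allPn; exists A => //; apply/eqP => EA.
  by move: E; rewrite -EA place_prefix_bit => /ins1_neq.
have sub b : exists t, leaves t =i subpartition c b Q.
  by apply: IH (subpartition_partition b pQ pc); rewrite (leq_trans (proper b)).
have [l hl] := sub (left_bit c); have [r hr] := sub (~~ left_bit c).
exists (Caret c l r) => A /=; rewrite mem_cat; apply/orP/idP.
  by case=> /mapP[B hB ->]; [rewrite hl in hB | rewrite hr in hB];
    rewrite -mem_subpartition.
move=> hA; have [b [B EA]] := pc _ hA; move: hA; rewrite EA -mem_subpartition.
have [->|nb] := eqVneq b (left_bit c); first by rewrite -hl => ?; left; apply: map_f.
have -> : b = ~~ left_bit c by case: (b) (left_bit c) nb => [] [].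
by rewrite -hr => ?; right; apply: map_f.
Qed.

(** The target tree is not given: the images of the leaves of [S] form a partition, and [guillotine]
    turns it into a tree. *)
Lemma tree_reach d S f : (num_leaves S <= 2 ^ d + 2)%N -> bijective f ->
  (forall A, A \in leaves S -> exists B, carries f A B) ->
  reach (num_leaves S * (12 * d + 53)) f.
Proof.
move=> len bijf fS; have injf := bij_inj bijf.
have ex A : exists B, A \in leaves S -> carries f A B.
  by have [/fS[B hB]|_] := boolP (A \in leaves S); [exists B | exists A].
have [phi hphi] := choice ex.
have disj A B z w : A \in leaves S -> B \in leaves S ->
    place (phi A) z = place (phi B) w -> A = B.
  move=> hA hB; rewrite -hphi // -hphi // => /injf; exact: (leaves_disjoint hA hB).
have injphi : {in leaves S &, injective phi}.
  by move=> A B hA hB E; apply: (disj _ _ (origin R) (origin R)); rewrite // E.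
have pQ : rect_partition (map phi (leaves S)).
  split; first by rewrite map_inj_in_uniq // leaves_uniq.
    move=> z; have [g _ gK] := bijf; rewrite -(gK z).
    have [A hA [w ->]] := leaves_cover S (g z).
    by exists (phi A); [exact: map_f | exists w; exact: hphi].
  by move=> _ _ z w /mapP[A hA ->] /mapP[B hB ->] /disj ->.
have [T hT] := guillotine pQ.
have eqn : num_leaves S = num_leaves T.
  rewrite -!size_leaves -(size_map phi).
  by apply/esym/perm_size/uniq_perm; rewrite ?leaves_uniq //; case: pQ.
apply: (tree_pair_reach eqn) => // i lti.
have : phi (leaf S i) \in leaves T by rewrite hT; apply: map_f; exact: leaf_mem.
move=> /(nthP ([::], [::]))[j]; rewrite size_leaves => ltj Ej.
by exists j => //; rewrite /leaf Ej; apply/hphi/leaf_mem.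
Qed.

End Partitions.

(** * Grid diagrams and their reduction *)

Section Grids.
Variable R : realType.
Notation sq := (usquare R).
Implicit Types (f x : sq -> sq) (z : sq) (A B C : address).

Definition good x A := exists B, carries x A B.

Lemma goodP x A : good x A <-> affine_on x (rect_set (rect_of A)) /\
  basic_dyadic_rectangle (x @` rect_set (rect_of A)).
Proof.
split=> [[B /carriesP[aff im]]|[aff [[I J] [/= /dyadic_validP[u ->] /dyadic_validP[v ->] im]]]].
  by split=> //; exists (rect_of B); split; rewrite ?dyadic_of_valid.
by exists (u, v); apply/carriesP.
Qed.

Lemma good_cat x A B : good x A -> good x (cat_address A B).
Proof. by move=> [C h]; exists (cat_address C B); exact: carries_cat. Qed.

Fixpoint bleaves (t : btree) : seq (seq bool) :=
  if t is BCaret l r then map (cons false) (bleaves l) ++ map (cons true) (bleaves r)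
  else [:: [::]].

Fixpoint exposed (t : btree) : seq (seq bool) :=
  match t with
  | BLeaf => [::]
  | BCaret BLeaf BLeaf => [:: [::]]
  | BCaret l r => map (cons false) (exposed l) ++ map (cons true) (exposed r)
  end.

Lemma leaf_intervalsE t : leaf_intervals t = map (dyadic_of dyadic_unit) (bleaves t).
Proof.
rewrite /leaf_intervals; elim: t dyadic_unit => //= l IHl r IHr D.
by rewrite IHl IHr map_cat -!map_comp.
Qed.

Lemma exposed_intervalsE t : exposed_intervals t = map (dyadic_of dyadic_unit) (exposed t).
Proof.
rewrite /exposed_intervals; elim: t dyadic_unit => // l IHl r IHr D.
case: l IHl => [|l1 l2] IHl; case: r IHr => [|r1 r2] IHr //.
- change (exposed_intervals_in (upper_half D) (BCaret r1 r2)
    = map (dyadic_of D) (map (cons true) (exposed (BCaret r1 r2)))).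
  by rewrite IHr -map_comp.
- change (exposed_intervals_in (lower_half D) (BCaret l1 l2) ++ [::]
    = map (dyadic_of D) (map (cons false) (exposed (BCaret l1 l2)) ++ [::])).
  by rewrite IHl !cats0 -map_comp.
- change (exposed_intervals_in (lower_half D) (BCaret l1 l2)
      ++ exposed_intervals_in (upper_half D) (BCaret r1 r2)
    = map (dyadic_of D) (map (cons false) (exposed (BCaret l1 l2))
      ++ map (cons true) (exposed (BCaret r1 r2)))).
  by rewrite IHl IHr map_cat -!map_comp.
Qed.

(** An inversion principle, since the overlapping patterns of [exposed] block simplification while
    the children are unknown. *)
Lemma exposedP l r u : u \in exposed (BCaret l r) <->
  [\/ [/\ l = BLeaf, r = BLeaf & u = [::]],
      exists2 w, w \in exposed l & u = false :: w
    | exists2 w, w \in exposed r & u = true :: w].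
Proof.
have E : [\/ [/\ l = BLeaf, r = BLeaf & exposed (BCaret l r) = [:: [::]]]
  | (l <> BLeaf \/ r <> BLeaf) /\ exposed (BCaret l r)
   = map (cons false) (exposed l) ++ map (cons true) (exposed r)].
  by case: l r => [|l1 l2] [|r1 r2]; [left | right | right | right]; split=> //;
    by [left | right].
case: E => [[-> -> ->]|[nlr ->]].
  rewrite inE; split=> [/eqP ->|[[_ _ ->]|[]|[]]] //; exact: Or31.
rewrite mem_cat; split.
  by case/orP=> /mapP[w hw ->]; [apply: Or32 | apply: Or33]; exists w.
case=> [[El Er _]|[w hw ->]|[w hw ->]]; first by case: nlr.
  by rewrite map_f.
by rewrite map_f ?orbT.
Qed.

Lemma exposed_children t u b : u \in exposed t -> rcons u b \in bleaves t.
Proof.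
elim: t u => // l IHl r IHr u /exposedP[[-> -> ->]|[w /IHl h ->]|[w /IHr h ->]].
- by case: (b).
- by rewrite /= mem_cat map_f.
- by rewrite /= mem_cat map_f ?orbT.
Qed.

Lemma collapse t u : u \in exposed t -> exists t',
  (size (bleaves t') < size (bleaves t))%N /\
  forall w, w \in bleaves t' -> w = u \/ w \in bleaves t.
Proof.
elim: t u => // l IHl r IHr u /exposedP[[-> -> ->]|[w /IHl [l' [lt h]] ->]|[w /IHr [r' [lt h]] ->]].
- by exists BLeaf; split=> // w; rewrite inE => /eqP ->; left.
- exists (BCaret l' r); split; first by rewrite /= !size_cat !size_map ltn_add2r.
  move=> v /=; rewrite !mem_cat => /orP[/mapP[w' /h[->|h'] ->]|->]; [by left|right..].
    by rewrite map_f.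
  by rewrite orbT.
- exists (BCaret l r'); split; first by rewrite /= !size_cat !size_map ltn_add2l.
  move=> v /=; rewrite !mem_cat => /orP[->|/mapP[w' /h[->|h'] ->]]; [by right|by left|right].
  by rewrite map_f // orbT.
Qed.

Lemma exposed_exists l r : exists u, u \in exposed (BCaret l r).
Proof.
suff ex t : t = BLeaf \/ exists u, u \in exposed t.
  by have [] := ex (BCaret l r).
elim: t => [|{}l IHl {}r IHr]; [by left|right].
have [El|[u hu]] := IHl; last first.
  by exists (false :: u); apply/exposedP; apply: Or32; exists u.
have [Er|[u hu]] := IHr; last first.
  by exists (true :: u); apply/exposedP; apply: Or33; exists u.
by exists [::]; apply/exposedP; apply: Or31.
Qed.

(** Every interior node lies above an exposed caret or is one, so a bound on the depth of exposed
    carets bounds the whole tree. *)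
Lemma size_bleaves_exposed t d : (forall u, u \in exposed t -> (size u < d)%N) ->
  (size (bleaves t) <= 2 ^ d)%N.
Proof.
elim: t d => [|l IHl r IHr] d h; first by rewrite expn_gt0.
have [u /h ltu] := exposed_exists l r.
case: d h ltu => // d h _; rewrite /= size_cat !size_map expnS mul2n -addnn.
apply: leq_add; [apply: IHl | apply: IHr] => w hw.
  by apply: (h (false :: w)); apply/exposedP; apply: Or32; exists w.
by apply: (h (true :: w)); apply/exposedP; apply: Or33; exists w.
Qed.

Definition good_grid x Tv Th :=
  forall u v, u \in bleaves Tv -> v \in bleaves Th -> good x (u, v).

Lemma grid_diagramP x Tv Th : grid_diagram x Tv Th <-> good_grid x Tv Th.
Proof.
rewrite /grid_diagram !leaf_intervalsE; split.
  by move=> h u v hu hv; apply/goodP; apply: h; exact: map_f.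
by move=> h _ _ /mapP[u hu ->] /mapP[v hv ->]; have /goodP := h _ _ hu hv.
Qed.

Lemma not_good x A : ~ good x A <-> ~ affine_on x (rect_set (rect_of A)) \/
  ~ basic_dyadic_rectangle (x @` rect_set (rect_of A)).
Proof. by rewrite -not_andP; split=> h /goodP. Qed.

Lemma reduced_grid_diagramP x Tv Th : reduced_grid_diagram x Tv Th <->
  [/\ good_grid x Tv Th,
    forall u, u \in exposed Tv -> exists2 v, v \in bleaves Th & ~ good x (u, v)
  & forall v, v \in exposed Th -> exists2 u, u \in bleaves Tv & ~ good x (u, v)].
Proof.
split=> [[/grid_diagramP g hv hh]|[/grid_diagramP g hv hh]]; split=> //.
- move=> u /(map_f (dyadic_of dyadic_unit)); rewrite -exposed_intervalsE => /hv[J].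
  by rewrite leaf_intervalsE => /mapP[v hJ ->] /(not_good x (u, v)); exists v.
- move=> v /(map_f (dyadic_of dyadic_unit)); rewrite -exposed_intervalsE => /hh[J].
  by rewrite leaf_intervalsE => /mapP[u hJ ->] /(not_good x (u, v)); exists u.
- move=> I; rewrite exposed_intervalsE => /mapP[u /hv[v hJ /not_good n] ->].
  by exists (dyadic_of dyadic_unit v) => //; rewrite leaf_intervalsE map_f.
- move=> I; rewrite exposed_intervalsE => /mapP[v /hh[u hJ /not_good n] ->].
  by exists (dyadic_of dyadic_unit u) => //; rewrite leaf_intervalsE map_f.
Qed.

(** Collapse any caret that violates reducedness; the total number of leaves decreases. *)
Lemma reduce_grid x Tv Th : good_grid x Tv Th -> exists Tv Th, reduced_grid_diagram x Tv Th.
Proof.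
have [n] := ubnP (size (bleaves Tv) + size (bleaves Th)).
elim: n Tv Th => // n IH Tv Th ltn g.
have [|nr] := pselect (reduced_grid_diagram x Tv Th); first by exists Tv, Th.
have [[u hu hg]|hu] := pselect (exists2 u, u \in exposed Tv &
    forall v, v \in bleaves Th -> good x (u, v)).
  have [Tv' [lt h]] := collapse hu; apply: (IH Tv' Th); first lia.
  by move=> w v /h[->|hw] hv; [exact: hg | exact: g].
have [[v hv hg]|hv] := pselect (exists2 v, v \in exposed Th &
    forall u, u \in bleaves Tv -> good x (u, v)).
  have [Th' [lt h]] := collapse hv; apply: (IH Tv Th'); first lia.
  by move=> u w hw /h[->|hw']; [exact: hg | exact: g].
case: nr; apply/reduced_grid_diagramP; split=> //.
  move=> u eu; apply: contrapT => n2; apply: hu; exists u => // v lv.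
  by apply: contrapT => ng; apply: n2; exists v.
move=> v ev; apply: contrapT => n2; apply: hv; exists v => // u lu.
by apply: contrapT => ng; apply: n2; exists u.
Qed.

Fixpoint full_btree (d : nat) : btree :=
  if d is d'.+1 then BCaret (full_btree d') (full_btree d') else BLeaf.

Lemma size_full_bleaf d u : u \in bleaves (full_btree d) -> size u = d.
Proof.
elim: d u => [|d IH] u /=; first by rewrite inE => /eqP ->.
by rewrite mem_cat => /orP[] /mapP[w /IH <- ->].
Qed.

Lemma reduced_exists x : in_2V x -> exists Tv Th, reduced_grid_diagram x Tv Th.
Proof.
(* Every cell of the uniform grid of this level lies in a leaf of [S]. *)
move=> [_ [S [T [s h]]]]; pose t := full_btree (num_leaves S).
apply: (@reduce_grid x t t) => u v /size_full_bleaf su /size_full_bleaf sv.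
have [||i lti [C ->]] := @address_extends_leaf S u v; rewrite ?su ?sv //.
apply: good_cat; exists (leaf T (s i)); exact: tree_pair_carries h lti.
Qed.

Lemma mem_leaves_hang u t A : A \in leaves (hang u t) ->
  exists B C, [/\ B \in leaves t, C \in leaves u & A = cat_address B C].
Proof.
elim: t A => [|c l IHl r IHr] A /=.
  by move=> hA; exists ([::], [::]), A; split; rewrite ?inE //; case: A {hA}.
rewrite mem_cat => /orP[] /mapP[A' hA ->].
  have [B [C [hB hC ->]]] := IHl _ hA.
  exists (prefix_bit c (left_bit c) B), C; rewrite mem_cat map_f //; split=> //.
  by case: (c).
have [B [C [hB hC ->]]] := IHr _ hA.
exists (prefix_bit c (~~ left_bit c) B), C; rewrite mem_cat map_f ?orbT //; split=> //.
by case: (c).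
Qed.

Lemma mem_leaves_v t A : A \in leaves (tree_of_v t) -> exists2 u, u \in bleaves t & A = (u, [::]).
Proof.
elim: t A => [|l IHl r IHr] A /=; first by rewrite inE => /eqP ->; exists [::].
rewrite mem_cat => /orP[] /mapP[A' hA ->].
  by have [u hu ->] := IHl _ hA; exists (false :: u); rewrite // mem_cat map_f.
by have [u hu ->] := IHr _ hA; exists (true :: u); rewrite // mem_cat map_f ?orbT.
Qed.

Lemma mem_leaves_h t A : A \in leaves (tree_of_h t) -> exists2 v, v \in bleaves t & A = ([::], v).
Proof.
elim: t A => [|l IHl r IHr] A /=; first by rewrite inE => /eqP ->; exists [::].
rewrite mem_cat => /orP[] /mapP[A' hA ->].
  by have [u hu ->] := IHr _ hA; exists (true :: u); rewrite // mem_cat map_f ?orbT.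
by have [u hu ->] := IHl _ hA; exists (false :: u); rewrite // mem_cat map_f.
Qed.

Lemma mem_leaves_grid Tv Th A : A \in leaves (grid_tree Tv Th) ->
  exists u v, [/\ u \in bleaves Tv, v \in bleaves Th & A = (u, v)].
Proof.
move=> /mem_leaves_hang[B [C [/mem_leaves_v[u hu ->] /mem_leaves_h[v hv ->] ->]]].
by exists u, v; rewrite /cat_address /= cats0.
Qed.

Lemma num_leaves_carets t : num_leaves t = (num_carets t).+1.
Proof. by elim: t => //= c l -> r ->; rewrite addSn addnS. Qed.

Lemma num_leaves_grid Tv Th :
  num_leaves (grid_tree Tv Th) = (size (bleaves Tv) * size (bleaves Th))%N.
Proof.
have hv t : num_leaves (tree_of_v t) = size (bleaves t).
  by elim: t => //= l -> r ->; rewrite size_cat !size_map.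
have hh t : num_leaves (tree_of_h t) = size (bleaves t).
  by elim: t => //= l -> r ->; rewrite size_cat !size_map addnC.
have hang_ u t : num_leaves (hang u t) = (num_leaves t * num_leaves u)%N.
  by elim: t => [|c l IHl r IHr] /=; rewrite ?mul1n // IHl IHr mulnDl.
by rewrite hang_ hv hh.
Qed.

Lemma grid_reach d x Tv Th : bijective x -> grid_diagram x Tv Th ->
  (num_carets (grid_tree Tv Th) < 2 ^ d + 2)%N ->
  reach ((num_carets (grid_tree Tv Th)).+1 * (12 * d + 53)) x.
Proof.
move=> bij /grid_diagramP g; rewrite -num_leaves_carets => lt.
apply: tree_reach => // A /mem_leaves_grid[u [v [hu hv ->]]]; exact: g.
Qed.

End Grids.

(** * Level loss and the two bounds *)

Section LowerBound.
Variable R : realType.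
Notation sq := (usquare R).
Implicit Types (f g x : sq -> sq) (z : sq) (A B C : address).

Definition level_loss k f := forall u v, (k <= size u)%N -> (k <= size v)%N ->
  exists u' v', [/\ carries f (u, v) (u', v'), (size u <= size u' + k)%N
                  & (size v <= size v' + k)%N].

(** At worst the image of a leaf has no bits at all, and then only the bits of the leaf are lost,
    fewer than [k] in each direction. *)
Lemma level_loss_table k S f (B : nat -> address) : (num_leaves S <= k)%N ->
  (forall i, (i < num_leaves S)%N -> carries f (leaf S i) (B i)) -> level_loss k f.
Proof.
move=> lek h u v hu hv.
have [i lti [C E]] := address_extends_leaf (leq_trans lek hu) (leq_trans lek hv).
have [d1 d2] := depth_leaf (leaf_mem lti).
exists ((B i).1 ++ C.1), ((B i).2 ++ C.2); rewrite E; split; first exact: carries_cat (h i lti).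
  case: E => -> _; rewrite !size_cat addnAC leq_add2r (leq_trans (ltnW d1)) //.
  by rewrite (leq_trans lek) // leq_addl.
case: E => _ ->; rewrite !size_cat addnAC leq_add2r (leq_trans (ltnW d2)) //.
by rewrite (leq_trans lek) // leq_addl.
Qed.

Lemma letter_level_loss f : letter f -> level_loss 4 f.
Proof.
move=> [gf|[g [gg gK _]]].
  have [S [T [s [h le4]]]] := generator_tree_pair gf.
  by apply: (level_loss_table (B := leaf T \o s) le4) => i; exact: tree_pair_carries h.
have [S [T [s [h le4]]]] := generator_tree_pair gg.
have [eqn [_ _ surj] _] := h.
have ex j : exists i, (j < num_leaves T)%N -> (i < num_leaves S)%N /\ s i = j.
  by have [/surj[i lti Ei]|_] := boolP (j < num_leaves T)%N; [exists i | exists 0%N].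
have [s' hs'] := choice ex; rewrite eqn in le4.
apply: (level_loss_table (B := leaf S \o s') le4) => j ltj /=.
have [lti Ei] := hs' j ltj; rewrite -{1}Ei.
exact: carries_inv gK (tree_pair_carries h lti).
Qed.

Lemma product_level_loss n f : product_of_letters n f -> level_loss (4 * n) f.
Proof.
elim=> [|{}n g {}f lg _ IH] u v hu hv.
  by exists u, v; split=> //; rewrite addn0.
have [||u1 [v1 [h1 hu1 hv1]]] := IH u v; try lia.
(* At most 4n of at least 4n + 4 levels are gone, so the next letter still applies. *)
have [||u2 [v2 [h2 hu2 hv2]]] := letter_level_loss lg (u := u1) (v := v1); try lia.
by exists u2, v2; split; [exact: carries_comp h1 h2 | lia | lia].
Qed.

Lemma cat_same_suffix (T : Type) (s t w : seq T) : s ++ w = t ++ w -> s = t.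
Proof.
move=> E; have szE : size s = size t.
  by have := congr1 size E; rewrite !size_cat => /eqP; rewrite eqn_add2r => /eqP.
by have := congr1 (take (size s)) E; rewrite take_size_cat // szE take_size_cat.
Qed.

(* The narrow subcell forces the two images to be the two halves of one cell. *)
Lemma good_glue_v x (u v w : seq bool) : (forall b, good x (rcons u b, v)) ->
  good x (u, v ++ w) -> good x (u, v).
Proof.
move=> hb [[p q] hw].
have half_image b : exists q', q' ++ w = q /\ carries x (rcons u b, v) (rcons p b, q').
  have [[p' q'] h] := hb b; exists q'.
  have e1 : carries x (rcons u b, v ++ w) (p', q' ++ w).
    by have := @carries_cat R x _ _ ([::], w) h; rewrite /cat_address /= !cats0.
  have e2 : carries x (rcons u b, v ++ w) (rcons p b, q).
    by have := @carries_cat R x _ _ ([:: b], [::]) hw; rewrite /cat_address /= !cats0 !cats1.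
  by have [Ep Eq] := carries_uniq e1 e2; split=> //; rewrite -Ep.
have [q0 [E0 h0]] := half_image false; have [q1 [E1 h1]] := half_image true.
rewrite (@cat_same_suffix _ q1 q0 w) ?E1 // in h1.
exists (p, q0); apply: (carries_glue (c := Triangular));
  by rewrite /cat_address /= !cats0 !cats1.
Qed.

Lemma good_glue_h x (u v w : seq bool) : (forall b, good x (u, rcons v b)) ->
  good x (u ++ w, v) -> good x (u, v).
Proof.
move=> hb [[p q] hw].
have half_image b : exists p', p' ++ w = p /\ carries x (u, rcons v b) (p', rcons q b).
  have [[p' q'] h] := hb b; exists p'.
  have e1 : carries x (u ++ w, rcons v b) (p' ++ w, q').
    by have := @carries_cat R x _ _ (w, [::]) h; rewrite /cat_address /= !cats0.
  have e2 : carries x (u ++ w, rcons v b) (p, rcons q b).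
    by have := @carries_cat R x _ _ ([::], [:: b]) hw; rewrite /cat_address /= !cats0 !cats1.
  by have [Ep Eq] := carries_uniq e1 e2; split=> //; rewrite -Eq.
have [p0 [E0 h0]] := half_image false; have [p1 [E1 h1]] := half_image true.
rewrite (@cat_same_suffix _ p1 p0 w) ?E1 // in h1.
exists (p0, q); apply: (carries_glue (c := Square));
  by rewrite /cat_address /= !cats0 !cats1.
Qed.

(** At an exposed caret of depth at least 4n, both halves are good in every row as grid cells, and a
    strip of height level at least 4n is good by [product_level_loss]. Gluing makes the caret
    collapsible, against reducedness. Each of the two trees thus has at most 2^(4n) leaves. *)
Lemma reduced_size n x Tv Th : product_of_letters n x ->
  reduced_grid_diagram x Tv Th ->
  (num_carets (grid_tree Tv Th) < 2 ^ (8 * n))%N.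
Proof.
move=> /product_level_loss loss /reduced_grid_diagramP[g hv hh].
have goodL u v : (4 * n <= size u)%N -> (4 * n <= size v)%N -> good x (u, v).
  by move=> hu hv'; have [u' [v' [h _ _]]] := loss u v hu hv'; exists (u', v').
have sv : (size (bleaves Tv) <= 2 ^ (4 * n))%N.
  apply: size_bleaves_exposed => u eu; rewrite ltnNge; apply/negP => leu.
  have [v lv] := hv u eu; apply; apply: (@good_glue_v _ _ _ (nseq (4 * n) false)).
    by move=> b; apply: g => //; exact: exposed_children.
  by apply: goodL => //; rewrite size_cat size_nseq leq_addl.
have sh : (size (bleaves Th) <= 2 ^ (4 * n))%N.
  apply: size_bleaves_exposed => v ev; rewrite ltnNge; apply/negP => lev.
  have [u lu] := hh v ev; apply; apply: (@good_glue_h _ _ _ (nseq (4 * n) false)).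
    by move=> b; apply: g => //; exact: exposed_children.
  by apply: goodL => //; rewrite size_cat size_nseq leq_addl.
rewrite -num_leaves_carets num_leaves_grid.
have -> : (8 * n = 4 * n + 4 * n)%N by lia.
by rewrite expnD leq_mul.
Qed.

(** Some word for [x] exists, so a shortest one does, and [xget] does not return its default. *)
Lemma word_length_spec n x : reach n x ->
  (word_length x <= n)%N /\ product_of_letters (word_length x) x.
Proof.
move=> [m lem hm].
have ex : exists k, `[< product_of_letters k x >] by exists m; apply/asboolP.
have [|wl min] := @xgetPex _ 0%N [set k | product_of_letters k x /\
    forall j, product_of_letters j x -> (k <= j)%N].
  case: (ex_minnP ex) => k /asboolP hk min; exists k; split=> // j hj.
  by apply: min; apply/asboolP.
by split=> //; apply: leq_trans lem; exact: min.
Qed.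

(** [xget] picks some reduced diagram; both bounds are proved for an arbitrary one. *)
Lemma grid_carets_spec x : in_2V x -> exists Tv Th,
  reduced_grid_diagram x Tv Th /\ grid_carets x = num_carets (grid_tree Tv Th).
Proof.
move=> /reduced_exists[Tv [Th h]].
apply: (@xgetPex _ 0%N [set m | exists Tv Th,
  reduced_grid_diagram x Tv Th /\ m = num_carets (grid_tree Tv Th)]).
by exists (num_carets (grid_tree Tv Th)), Tv, Th.
Qed.

(** * Numerical estimates and conclusion *)

Lemma ln2_le1 : ln 2 <= 1 :> R.
Proof. by have := @le_ln1Dx R 1; rewrite (_ : 1 + 1 = 2 :> R) //; apply; lra. Qed.

(** From exp(-1/2) >= 1/2 follows exp(1/2) <= 2. *)
Lemma ln2_ge_half : 1 / 2 <= ln 2 :> R.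
Proof.
have e : expR (- (1 / 2) : R) >= 1 / 2 by have := expR_ge1Dx (- (1 / 2) : R); lra.
rewrite -ler_expR lnK ?posrE //.
have := expRxMexpNx_1 (1 / 2 : R); have := expR_gt0 (1 / 2 : R).
by nra.
Qed.

(** With L = ln M >= 1/2, the rounded-up binary logarithm is at most 1 + 2L, so the second factor is
    at most 65 + 24L <= 154L; and M + 1 <= 2M gives 308. *)
Lemma linearithmic_bound M : (1 < M)%N ->
  ((M.+1 * (12 * up_log 2 M + 53))%N%:R : R) <= 308 * (M%:R * ln M%:R).
Proof.
move=> M1; set d' := up_log 2 M.
have d0 : (0 < d')%N by rewrite up_log_gt0.
have l2 := ln2_ge_half.
have Mpos : 0 < M%:R :> R by rewrite ltr0n ltnW.
have lnM : ln 2 *+ d'.-1 <= ln M%:R :> R.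
  rewrite -lnXn // ler_ln ?posrE ?exprn_gt0 //.
  by rewrite -natrX ler_nat ltnW // up_log_gtn.
have lnM2 : 1 / 2 <= ln M%:R :> R.
  by apply: le_trans l2 _; rewrite ler_ln ?posrE // ler_nat.
have Ed : (d'%:R : R) = d'.-1%:R + 1 by rewrite natr1 prednK.
have dle : (d'%:R : R) <= 1 + 2 * ln M%:R.
  rewrite Ed; move: lnM; rewrite -[_ *+ _]mulr_natr.
  have := ler_wpM2r (ler0n R d'.-1) l2; lra.
rewrite natrM natrD natrM -natr1.
have M1' : 1 <= M%:R :> R by rewrite ler1n ltnW.
have : 12 * d'%:R + 53 <= 154 * ln M%:R :> R by lra.
move: (M%:R : R) (ln _) (12 * _ + 53) M1' lnM2 => m l e; nra.
Qed.

End LowerBound.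

Theorem theorem4p1 (R : realType) :
  exists2 C : R, 0 < C &
    forall x : usquare R -> usquare R, in_2V x ->
      ln (grid_carets x)%:R <= C * (word_length x)%:R + C /\
      (word_length x)%:R
        <= C * ((grid_carets x)%:R * ln (grid_carets x)%:R) + C.
Proof.
exists 308; first by rewrite ltr0n.
move=> x x2V; have [bijx _] := x2V.
have [Tv [Th [red ->]]] := grid_carets_spec x2V; have [grid _ _] := red.
set M := num_carets _.
have ltM : (M < 2 ^ up_log 2 M + 2)%N.
  by rewrite (leq_ltn_trans (up_logP M (ltnSn 1))) // addn2 ltnS leqnSn.
have [wle wprod] := word_length_spec (grid_reach bijx grid ltM).
have := reduced_size wprod red; rewrite -/M => ltML.
have w0 : 0 <= (word_length x)%:R :> R by [].
split.
  have [M0|M0] := posnP M; first by have := @ln_le0 R 0 ler01; rewrite M0; lra.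
  have : ln (M%:R : R) <= ln (2 ^+ (8 * word_length x)).
    by rewrite ler_ln ?posrE ?exprn_gt0 ?ltr0n // -natrX ler_nat ltnW.
  rewrite lnXn // -[ln _ *+ _]mulr_natl natrM.
  by have := ler_wpM2l w0 (ln2_le1 R); lra.
have wle' : (word_length x)%:R <= (M.+1 * (12 * up_log 2 M + 53))%N%:R :> R.
  by rewrite ler_nat.
(* For M <= 1 the product M ln M vanishes and [up_log] is 0, so the additive constant has to absorb
   at most 2 * 53 letters. *)
have [M1|M1] := leqP M 1; last by have := linearithmic_bound R M1; lra.
have ln0 : ln (M%:R : R) = 0.
  by case: (M) M1 => [|[|//]] _; rewrite ?ln1 // ln0.
rewrite ln0 mulr0 mulr0 add0r; apply: le_trans wle' _.
by rewrite ler_nat; case: (M) M1 => [|[|//]].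
Qed.
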